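(* Let $1<p<\infty$ and $V\in S_p$. For any given $f\in L^2(\Omega)$, the boundary value problem $$-\left(y^{2\alpha_1}\partial_x^2u+x^{2\alpha_2}\partial_y^2u\right)+Vu=f\ \text{ in }\Omega,\qquad u=0\ \text{ on }\partial\Omega,$$ has a unique weak solution $u\in H_0(\Omega)$.
   Context: Let $\alpha_1,\alpha_2\in(0,\frac12)$, $\Omega=\{(x,y)\in\mathbb R^2: 0<x<1,\ 0<y<1\}$, $M>0$ a constant, and $S_p=\{V\in L^p(\Omega): V\ge 0 \text{ a.e.},\ \|V\|_{L^p(\Omega)}\le M\}$. $\mathcal H^1(\Omega)=\{u\in L^2(\Omega): y^{\alpha_1}\partial_xu\in L^2(\Omega),\ x^{\alpha_2}\partial_yu\in L^2(\Omega)\}$ (distributional derivatives), with norm $\left(\|u\|_{L^2}^2+\|y^{\alpha_1}\partial_xu\|_{L^2}^2+\|x^{\alpha_2}\partial_yu\|_{L^2}^2\right)^{1/2}$; $\mathcal H_0^1(\Omega)$ is the closure of $C_0^\infty(\Omega)$ in $\mathcal H^1(\Omega)$; $H_0(\Omega)=\{u\in\mathcal H_0^1(\Omega): \iint_\Omega Vu^2\,dxdy<\infty\}$. A function $u\in H_0(\Omega)$ is a weak solution of the problem if $a(u,v)=\iint_\Omega fv\,dxdy$ for all $v\in H_0(\Omega)$, where $$a(u,v)=\iint_\Omega (y^{\alpha_1}\partial_xu)(y^{\alpha_1}\partial_xv)+(x^{\alpha_2}\partial_yu)(x^{\alpha_2}\partial_yv)+Vuv\,dxdy.$$ *)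

(* Defs.v *)
From HB Require Import structures.
From mathcomp Require Import all_boot all_order all_algebra.
From mathcomp Require Import all_classical all_reals all_analysis.

Set Implicit Arguments.
Unset Strict Implicit.
Unset Printing Implicit Defensive.
Import Order.TTheory GRing.Theory Num.Theory.
Import numFieldNormedType.Exports.
Local Open Scope classical_set_scope.
Local Open Scope ring_scope.

(* Elements of the function spaces below are represented by total functions
   on the plane whose values outside Omega are irrelevant; equality in these
   spaces is equality almost everywhere in Omega. *)

Section Degenerate.
Context {R : realType}.
Implicit Types (u v w f V phi : R * R -> R).

Definition leb2 :
    {measure set (measurableTypeR R * measurableTypeR R) -> \bar R} :=
  (@lebesgue_measure R \x @lebesgue_measure R)%E.

Definition Omega : set (R * R) := `]0, 1[%classic `*` `]0, 1[%classic.

Definition ex : R * R := (1, 0).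
Definition ey : R * R := (0, 1).

Definition Lp (p : R) : set (R * R -> R) :=
  [set f | (f \_ Omega) \in Lfun leb2 p%:E].

Definition Lp_norm (p : R) f : R := fine ('N[leb2]_(p%:E)[EFin \o (f \_ Omega)])%E.

Definition S_ (p M : R) : set (R * R -> R) :=
  [set V | [/\ Lp p V, {ae leb2, forall z, Omega z -> 0 <= V z}
             & Lp_norm p V <= M]].

(* A word s in ex, ey encodes the iterated partial derivative of phi, the
   last letter of s being differentiated first. *)
Definition partials (s : seq (R * R)) phi : R * R -> R :=
  foldr (fun e g => 'D_e g) phi s.

Definition smooth phi : Prop :=
  forall s : seq (R * R), {subset s <= [:: ex; ey]} ->
    continuous (partials s phi) /\
    forall z, derivable (partials s phi) z ex /\ derivable (partials s phi) z ey.

Definition test_function : set (R * R -> R) :=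
  [set phi | smooth phi /\
     exists K : set (R * R), [/\ compact K, K `<=` Omega &
       forall z, ~ K z -> phi z = 0]].

Definition locally_integrable_Omega w : Prop :=
  measurable_fun Omega w /\
  forall K : set (R * R), compact K -> K `<=` Omega ->
    leb2.-integrable K (EFin \o w).

Definition is_weak_partial (e : R * R) u w : Prop :=
  [/\ locally_integrable_Omega u, locally_integrable_Omega w &
      forall phi, test_function phi ->
        \int[leb2]_(z in Omega) (u z * 'D_e phi z)
        = - \int[leb2]_(z in Omega) (w z * phi z)].

Definition has_weak_partial (e : R * R) u : Prop :=
  exists w, is_weak_partial e u w.

(* A representative of the weak derivative; zero if there is none. *)
Definition weak_partial (e : R * R) u : R * R -> R :=
  xget (fun=> 0) [set w | is_weak_partial e u w].

Definition wdx (a1 : R) u : R * R -> R :=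
  fun z => z.2 `^ a1 * weak_partial ex u z.
Definition wdy (a2 : R) u : R * R -> R :=
  fun z => z.1 `^ a2 * weak_partial ey u z.

(* The product of the smooth weight with a distribution T lies in L^2(Omega)
   only if T is locally integrable, the weight being bounded away from 0 on
   compact subsets of Omega. *)
Definition H1 (a1 a2 : R) : set (R * R -> R) :=
  [set u | [/\ Lp 2 u,
               has_weak_partial ex u /\ Lp 2 (wdx a1 u) &
               has_weak_partial ey u /\ Lp 2 (wdy a2 u)]].

Definition H1_norm (a1 a2 : R) u : R :=
  Num.sqrt (Lp_norm 2 u ^+ 2 + Lp_norm 2 (wdx a1 u) ^+ 2
            + Lp_norm 2 (wdy a2 u) ^+ 2).

Definition H1_0 (a1 a2 : R) : set (R * R -> R) :=
  [set u | H1 a1 a2 u /\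
     forall eps : R, 0 < eps ->
       exists2 phi, test_function phi & H1_norm a1 a2 (u \- phi) < eps].

Definition H_0 (a1 a2 : R) V : set (R * R -> R) :=
  [set u | H1_0 a1 a2 u /\
     (\int[leb2]_(z in Omega) (V z * u z ^+ 2)%:E < +oo)%E].

Definition a_form (a1 a2 : R) V u v : R :=
  \int[leb2]_(z in Omega)
    (wdx a1 u z * wdx a1 v z + wdy a2 u z * wdy a2 v z + V z * u z * v z).

(* Weak solution of - (y^(2 a1) u_xx + x^(2 a2) u_yy) + V u = f in Omega with
   u = 0 on the boundary of Omega. *)
Definition weak_solution (a1 a2 : R) V f u : Prop :=
  H_0 a1 a2 V u /\
  forall v, H_0 a1 a2 V v ->
    a_form a1 a2 V u v = \int[leb2]_(z in Omega) (f z * v z).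

End Degenerate.

(* Main.v *)
Require Import Defs.
From HB Require Import structures.
From mathcomp Require Import all_boot all_order all_algebra.
From mathcomp Require Import all_classical all_reals all_analysis.
From mathcomp Require Import measurable_realfun ring lra.
Import Order.TTheory GRing.Theory Num.Theory.
Import numFieldNormedType.Exports.
Set Implicit Arguments.
Unset Strict Implicit.
Unset Printing Implicit Defensive.
Local Open Scope classical_set_scope.
Local Open Scope ring_scope.

(** The weak problem asks for the Riesz representative of [v |-> int f v] with
    respect to the form [a] on [H_0], so the theorem holds because [a] is a
    positive semidefinite form for which [H_0] is complete and which controls
    the L^2 norm.

    Control of the L^2 norm ([poincare]) is where the exponents below 1/2
    matter.  A test function satisfies both [|phi(x,y)| <= int |phi_x(t,y)| dt]
    and [|phi(x,y)| <= int |phi_y(x,s)| ds]; multiplying and integrating gives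
    [int phi^2 <= (int |phi_x|) (int |phi_y|)] ([gagliardo_nirenberg]).  Each
    factor is the L^2 product of a weighted derivative with the inverse weight
    [y^(-a1)] or [x^(-a2)], which is square integrable exactly because the
    exponent is below 1/2 ([L2_inv_powR_snd], [L2_inv_powR_fst]).  Density of
    the test functions extends the inequality to [H1_0].

    Completeness ([H_0_complete]) comes from completeness of L^2
    ([L2_complete]) applied to [u], to its two weighted derivatives and to
    [sqrt V * u].  The limits are identified by the closedness of weak
    differentiation ([wder_closed]), where square integrability of the inverse
    weights is used once more, and by almost everywhere convergence along a
    subsequence for the potential term.

    The space is made of functions and not of classes, and [weak_partial]
    chooses a representative of the weak derivative.  Linearity of this choice,
    up to null sets, rests on the uniqueness of weak derivatives, that is, on
    the fundamental lemma of the calculus of variations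
    ([test_function_separate]).  It is proved with explicit bumps
    [exp (- 1 / (n q))], which converge boundedly to the indicator of an open
    rectangle, followed by a Dynkin class argument.

    Existence is then [riesz_representation], the minimisation of
    [a u u - 2 int f u].  For uniqueness, the difference [w] of two solutions
    satisfies [a w w = 0], hence [int w^2 = 0] by [poincare]. *)

(** * Riesz representation for positive semidefinite forms *)

(** The elements of the function spaces are plain functions; closure of a nonempty
    set under this single operation makes it a vector subspace. *)
Definition comb {R : realType} {T : Type} (u : T -> R) (t : R) (v : T -> R) :
  T -> R := fun z => u z + t * v z.

(** Only semidefinite, since functions that agree almost everywhere are not
    identified. *)
Record psd_form (R : realType) (T : Type) (H : set (T -> R))
    (a : (T -> R) -> (T -> R) -> R) : Prop := PsdForm {
  psd_comb : forall u t v, H u -> H v -> H (comb u t v);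
  psd_sym : forall u v, H u -> H v -> a u v = a v u;
  psd_lin : forall u t v w, H u -> H v -> H w ->
    a (comb u t v) w = a u w + t * a v w;
  psd_ge0 : forall u, H u -> 0 <= a u u }.

Section psd_form_theory.
Context {R : realType} {T : Type} (H : set (T -> R)).
Context (a : (T -> R) -> (T -> R) -> R) (aH : psd_form H a).
Implicit Types u v w : T -> R.

Lemma psd_lin_r u t v w : H u -> H v -> H w ->
  a w (comb u t v) = a w u + t * a w v.
Proof.
move=> Hu Hv Hw; have Huv := psd_comb aH t Hu Hv.
by rewrite (psd_sym aH)// (psd_lin aH)// (psd_sym aH Hu)// (psd_sym aH Hv).
Qed.

Lemma psd_sq u t v : H u -> H v ->
  a (comb u t v) (comb u t v) = a u u + 2 * t * a u v + t ^+ 2 * a v v.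
Proof.
move=> Hu Hv; have Huv := psd_comb aH t Hu Hv.
rewrite (psd_lin aH)// !psd_lin_r// (psd_sym aH Hv Hu); ring.
Qed.

(** The quadratic polynomial [t |-> a (u + t v) (u + t v)] is nonnegative. *)
Lemma psd_cauchy_schwarz u v : H u -> H v -> a u v ^+ 2 <= a u u * a v v.
Proof.
move=> Hu Hv.
have q t : 0 <= a u u + 2 * t * a u v + t ^+ 2 * a v v.
  by rewrite -psd_sq//; exact/(psd_ge0 aH)/(psd_comb aH).
have := psd_ge0 aH Hu; have := psd_ge0 aH Hv.
move: (a u u) (a u v) (a v v) q => p b c q.
rewrite le_eqVlt => /orP[/eqP c0|c0] p0.
  (* the polynomial is affine; were its slope nonzero, it would take the value -1 *)
  have := q (- (p + 1) / (2 * b)); have [->|b0] := eqVneq b 0; first by rewrite -c0; lra.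
  rewrite -c0 mulr0 addr0.
  have -> : p + 2 * (- (p + 1) / (2 * b)) * b = -1 by field.
  lra.
have := q (- b / c).
have -> : p + 2 * (- b / c) * b + (- b / c) ^+ 2 * c = (p * c - b ^+ 2) / c.
  by field; rewrite gt_eqF.
by rewrite pmulr_lge0 ?invr_gt0// subr_ge0.
Qed.

(** By the parallelogram identity, the two sides differ by the value of the
    form at [u - t v]. *)
Lemma psd_comb_le u t v : H u -> H v ->
  a (comb u t v) (comb u t v) <= 2 * a u u + 2 * t ^+ 2 * a v v.
Proof.
move=> Hu Hv; rewrite -subr_ge0.
have -> : 2 * a u u + 2 * t ^+ 2 * a v v - a (comb u t v) (comb u t v) =
          a (comb u (- t) v) (comb u (- t) v).
  rewrite !psd_sq//; ring.
exact/(psd_ge0 aH)/(psd_comb aH).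
Qed.

(** The linear term dominates for small [t]; the witness is of size
    [b / (1 + |c|)] so that no case distinction on [c] is needed. *)
Lemma quad_ge0_lin0 (b c : R) :
  (forall t : R, 0 <= 2 * t * b + t ^+ 2 * c) -> b = 0.
Proof.
move=> q; have [//|b0] := eqVneq b 0.
have c0 : 0 < 1 + `|c| by rewrite ltr_pwDl.
have := q (- b / (1 + `|c|)).
have -> : 2 * (- b / (1 + `|c|)) * b + (- b / (1 + `|c|)) ^+ 2 * c =
   b ^+ 2 / (1 + `|c|) ^+ 2 * (c - 2 * (1 + `|c|)).
  by field; rewrite gt_eqF.
have b2 : 0 < b ^+ 2 by rewrite lt0r sqrf_eq0 b0 sqr_ge0.
rewrite pmulr_rge0; last by rewrite divr_gt0 ?(exprn_gt0 _ c0).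
by have := ler_norm c; have := normr_ge0 c; lra.
Qed.

(** Minimise [J u = a u u - 2 l u], which is bounded below because [l] is
    bounded for [a].  The parallelogram identity makes a minimising sequence
    Cauchy, and the first variation of [J] vanishes at its limit.  Completeness
    is asked as existence of a cluster point: the variational inequality along
    the sequence passes to the limit along any infinite set of indices. *)
Lemma riesz_representation (l : (T -> R) -> R) (C : R) :
  H !=set0 ->
  (forall u t v, H u -> H v -> l (comb u t v) = l u + t * l v) ->
  (forall u, H u -> l u ^+ 2 <= C * a u u) ->
  (forall u_ : nat -> T -> R, (forall n, H (u_ n)) ->
    (forall eps : R, 0 < eps -> exists N, forall m n, (N <= m)%N -> (N <= n)%N ->
       a (comb (u_ m) (-1) (u_ n)) (comb (u_ m) (-1) (u_ n)) <= eps) ->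
    exists2 u, H u & forall (eps : R) N, 0 < eps -> exists2 n, (N <= n)%N &
       a (comb u (-1) (u_ n)) (comb u (-1) (u_ n)) <= eps) ->
  exists2 u, H u & forall v, H v -> a u v = l v.
Proof.
move=> [h0 Hh0] llin lC complete.
pose J u := a u u - 2 * l u.
have JC u : H u -> - `|C| <= J u.
  move=> Hu; have := lC _ Hu; have a0 := psd_ge0 aH Hu; rewrite /J.
  have : C * a u u <= `|C| * a u u by rewrite ler_wpM2r// ler_norm.
  have := normr_ge0 C; move: (a u u) (l u) `|C| (C * _) a0 => p b c d p0 c0 h1 h2.
  have [//|hb] := lerP (- c) (p - 2 * b).
  have : 0 < (2 * b - p - c) * (2 * b + p + c) by rewrite mulr_gt0//; lra.
  have := sqr_ge0 (p - c); have : b ^+ 2 <= c * p by exact: le_trans h1.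
  by clear; lra.
pose S := [set J u | u in H].
have Sinf : has_inf S.
  split; first by exists (J h0), h0.
  by exists (- `|C|) => _ [u Hu <-]; exact: JC.
have mle u : H u -> inf S <= J u by move=> Hu; apply: ge_inf; [exact: Sinf.2|exists u].
have /choice[u_ u_P] n : exists u, H u /\ J u < inf S + n.+1%:R^-1.
  have [_ [u Hu <-] ltu] := inf_adherent (ltac:(by rewrite invr_gt0 ltr0n) : 0 < n.+1%:R^-1 :> R) Sinf.
  by exists u.
have Hu_ n : H (u_ n) := (u_P n).1.
have JE u t v : H u -> H v ->
    J (comb u t v) = J u + 2 * t * (a u v - l v) + t ^+ 2 * a v v.
  by move=> Hu Hv; rewrite /J psd_sq// llin//; ring.
have inv_le N n : (N <= n)%N -> n.+1%:R^-1 <= N.+1%:R^-1 :> R.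
  by move=> Nn; rewrite lef_pV2 ?posrE ?ltr0n// ler_nat.
have small (eps : R) : 0 < eps -> exists N, forall n, (N <= n)%N -> n.+1%:R^-1 <= eps :> R.
  move=> eps0; exists (Num.truncn eps^-1) => n Nn.
  apply: le_trans (inv_le _ _ Nn) _.
  rewrite -[leRHS]invrK lef_pV2 ?posrE ?invr_gt0//.
  by apply: ltW; apply: truncnS_gt.
have cauchy (eps : R) : 0 < eps -> exists N, forall m n, (N <= m)%N -> (N <= n)%N ->
    a (comb (u_ m) (-1) (u_ n)) (comb (u_ m) (-1) (u_ n)) <= eps.
  move=> eps0; have [N NP] := small (eps / 4) ltac:(lra).
  exists N => m n Nm Nn.
  have Hd := psd_comb aH (-1) (Hu_ n) (Hu_ m).
  (* the infimum is compared with J at the midpoint of u_m and u_n *)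
  have := mle _ (psd_comb aH (2^-1) (Hu_ m) (psd_comb aH (-1) (Hu_ n) (Hu_ m))).
  have -> : J (comb (u_ m) 2^-1 (comb (u_ n) (-1) (u_ m))) =
      2^-1 * J (u_ m) + 2^-1 * J (u_ n) -
      4^-1 * a (comb (u_ m) (-1) (u_ n)) (comb (u_ m) (-1) (u_ n)).
    rewrite JE// /J !psd_sq// psd_lin_r// llin// (psd_sym aH (Hu_ n) (Hu_ m)); by field.
  have := (u_P m).2; have := (u_P n).2; have := NP _ Nm; have := NP _ Nn.
  move: (m.+1%:R^-1) (n.+1%:R^-1) (a _ _) (J _) (J _) => p q r s t.
  by clear; lra.
have [u Hu uP] := complete _ Hu_ cauchy.
exists u => // v Hv; apply/eqP; rewrite -subr_eq0; apply/eqP.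
(* J (u_n + t v) >= inf S > J u_n - 1 / (n + 1), with u_n arbitrarily close to u *)
apply: (@quad_ge0_lin0 _ (a v v)) => t.
apply/ler_addgt0Pl => eps eps0.
have [N NP] := small (eps / 2) ltac:(lra).
(* this closeness of u_n to u makes 2 t (a u_n v - a u v) at most eps / 2, by Cauchy-Schwarz *)
pose d := eps ^+ 2 / (16 * (1 + t ^+ 2) * (1 + a v v)).
have av0 := psd_ge0 aH Hv.
have t1 : 0 < 1 + t ^+ 2 by have := sqr_ge0 t; lra.
have d0 : 0 < d by rewrite divr_gt0 ?exprn_gt0// !mulr_gt0//; lra.
have [n Nn un] := uP d N d0.
have := mle _ (psd_comb aH t (Hu_ n) Hv); rewrite JE// => mn.
have := (u_P n).2; have := NP _ Nn => h1 h2.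
have cs : 2 * t * (a (u_ n) v - a u v) <= eps / 2.
  have := psd_cauchy_schwarz (psd_comb aH (-1) Hu (Hu_ n)) Hv.
  rewrite (psd_lin aH)// => cs.
  have cs2 : (a u v + -1 * a (u_ n) v) ^+ 2 <= d * a v v.
    by apply: le_trans cs _; rewrite ler_wpM2r.
  have cs3 : (2 * t * (a (u_ n) v - a u v)) ^+ 2 <= (eps / 2) ^+ 2.
    have -> : (2 * t * (a (u_ n) v - a u v)) ^+ 2 =
       4 * t ^+ 2 * (a u v + -1 * a (u_ n) v) ^+ 2 by ring.
    apply: (@le_trans _ _ (4 * t ^+ 2 * (d * a v v))).
      by rewrite ler_wpM2l// mulr_ge0// sqr_ge0.
    have dE : d * (16 * (1 + t ^+ 2) * (1 + a v v)) = eps ^+ 2.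
      by rewrite /d divfK// gt_eqF// !mulr_gt0//; lra.
    have dt0 : 0 <= d * t ^+ 2 by rewrite mulr_ge0 ?sqr_ge0// ltW.
    have := dt0.
    have : 0 <= d * a v v by rewrite mulr_ge0// ltW.
    have := d0.
    have : 0 <= d * t ^+ 2 * a v v by rewrite mulr_ge0.
    have -> : (eps / 2) ^+ 2 = eps ^+ 2 / 4 by field.
    rewrite -dE; move: (d) (t) (a v v) => x y z; lra.
  have e2 : 0 <= eps / 2 by lra.
  apply: le_trans (ler_norm _) _.
  by rewrite -(ger0_norm e2) -ler_sqr ?nnegrE// !real_normK ?num_real.
move: cs mn h1 h2; move: (n.+1%:R^-1) (a (u_ n) v) (a u v) (a v v) => i x y z.
by move: (J _) (inf _) (l v) => j m c; clear; lra.
Qed.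

End psd_form_theory.

Section psd_constructions.
Context {R : realType} {T : Type} (H : set (T -> R)).

Lemma psd_add (a b : (T -> R) -> (T -> R) -> R) : psd_form H a -> psd_form H b ->
  psd_form H (fun u v => a u v + b u v).
Proof.
move=> ha hb; split.
- exact: (psd_comb ha).
- by move=> u v Hu Hv; rewrite (psd_sym ha)// (psd_sym hb).
- by move=> u t v w Hu Hv Hw; rewrite (psd_lin ha)// (psd_lin hb)//; ring.
- by move=> u Hu; rewrite addr_ge0 ?(psd_ge0 ha)// (psd_ge0 hb).
Qed.

Lemma psd_restrict (H' : set (T -> R)) (a : (T -> R) -> (T -> R) -> R) : psd_form H a ->
  H' `<=` H -> (forall u t v, H' u -> H' v -> H' (comb u t v)) -> psd_form H' a.
Proof.
move=> ha sub cH; split => //.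
- by move=> u v /sub Hu /sub Hv; exact: (psd_sym ha).
- by move=> u t v w /sub Hu /sub Hv /sub Hw; exact: (psd_lin ha).
- by move=> u /sub Hu; exact: (psd_ge0 ha).
Qed.

End psd_constructions.

(** * Square-integrable functions *)

Section L2.
Context d (T : measurableType d) (R : realType).
Variables (mu : {measure set T -> \bar R}) (D : set T).
Hypothesis mD : measurable D.
Implicit Types f g h : T -> R.

Definition L2 : set (T -> R) :=
  [set f : T -> R | measurable_fun D f /\ mu.-integrable D (EFin \o (fun z => f z ^+ 2))].

Definition dot f g : R := \int[mu]_(z in D) (f z * g z).

Lemma integrable_bound f g : measurable_fun D f ->
  mu.-integrable D (EFin \o g) -> (forall z, D z -> `|f z| <= g z) ->
  mu.-integrable D (EFin \o f).
Proof.
move=> mf ig fg; apply: le_integrable ig => //; first exact/measurable_EFinP.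
move=> z Dz /=; rewrite lee_fin (le_trans (fg _ Dz))// ler_norm//.
Qed.

Lemma L2_integrableM f g : L2 f -> L2 g -> mu.-integrable D (EFin \o (fun z => f z * g z)).
Proof.
move=> [mf f2] [mg g2].
apply: (@integrable_bound _ (fun z => f z ^+ 2 + g z ^+ 2)).
- exact: measurable_funM.
- by have := integrableD mD f2 g2.
- move=> z _; rewrite normrM -(real_normK (num_real (f z))) -(real_normK (num_real (g z))).
  have := sqr_ge0 (`|f z| - `|g z|); have := sqr_ge0 (`|f z| + `|g z|); lra.
Qed.

Lemma L2_comb f t g : L2 f -> L2 g -> L2 (comb f t g).
Proof.
move=> Hf Hg; have [mf f2] := Hf; have [mg g2] := Hg; split.
  by apply: measurable_funD => //; exact: measurable_funM.
have fg := L2_integrableM Hf Hg.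
have := integrableD mD (integrableD mD f2 (integrableZl mD (2 * t) fg)) (integrableZl mD (t ^+ 2) g2).
apply: eq_integrable => // z _ /=; rewrite /comb -!EFinM -!EFinD; congr EFin; ring.
Qed.

Lemma dot_sym f g : dot f g = dot g f.
Proof. by apply: eq_Rintegral => z _; rewrite mulrC. Qed.

Lemma dot_comb f t g h : L2 f -> L2 g -> L2 h ->
  dot (comb f t g) h = dot f h + t * dot g h.
Proof.
move=> Hf Hg Hh; rewrite /dot -RintegralZl//; last exact: L2_integrableM.
rewrite -RintegralD//; last 2 first.
  exact: L2_integrableM.
  exact: (integrableZl mD t (L2_integrableM Hg Hh)).
by apply: eq_Rintegral => z _; rewrite /comb; ring.
Qed.

Lemma dot_psd : psd_form L2 dot.
Proof.
split; [exact: L2_comb|by move=> *; exact: dot_sym|exact: dot_comb|].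
by move=> u Hu; apply: Rintegral_ge0 => z _; rewrite -expr2 sqr_ge0.
Qed.

Lemma dot_ge0 f : L2 f -> 0 <= dot f f.
Proof. exact: (psd_ge0 dot_psd). Qed.

Lemma dot_cauchy_schwarz f g : L2 f -> L2 g -> dot f g ^+ 2 <= dot f f * dot g g.
Proof. exact: (psd_cauchy_schwarz dot_psd). Qed.

Lemma dotE f : L2 f -> (dot f f)%:E = (\int[mu]_(z in D) (f z ^+ 2)%:E)%E.
Proof.
move=> [mf f2]; rewrite /dot /Rintegral.
rewrite (_ : (fun x => _) = EFin \o (fun z => f z ^+ 2)); last first.
  by apply/funext => z /=; rewrite -expr2.
by rewrite fineK//; exact: integrable_fin_num.
Qed.

Lemma L2_lty f : measurable_fun D f ->
  (\int[mu]_(z in D) (f z ^+ 2)%:E < +oo)%E -> L2 f.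
Proof.
move=> mf fy; split => //; apply/integrableP; split.
  by apply/measurable_EFinP; exact: measurable_funX.
by under eq_integral do rewrite /= ger0_norm ?sqr_ge0//.
Qed.

Lemma dot0 f : L2 f -> dot f f = 0 -> {ae mu, forall z, D z -> f z = 0}.
Proof.
move=> Hf f0; have := dotE Hf; rewrite f0 => /esym ff0.
have /(ae_eq_integral_abs mu mD) : measurable_fun D (EFin \o (fun z => f z ^+ 2)).
  by apply/measurable_EFinP; apply: measurable_funX; exact: Hf.1.
move=> [+ _]; under eq_integral do rewrite /= ger0_norm ?sqr_ge0//.
move=> /(_ ff0); apply: filterS => z /= h /h [] /eqP.
by rewrite sqrf_eq0 => /eqP.
Qed.

Lemma L2_ae f g : measurable_fun D g -> {ae mu, forall z, D z -> f z = g z} ->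
  L2 f -> L2 g.
Proof.
move=> mg fg Hf; apply: L2_lty => //.
rewrite -(@ge0_ae_eq_integral _ _ _ _ _ (fun z => (f z ^+ 2)%:E))//.
- by rewrite -dotE// ltry.
- by apply/measurable_EFinP; apply: measurable_funX; exact: Hf.1.
- by apply/measurable_EFinP; exact: measurable_funX.
- by move=> z _; rewrite lee_fin sqr_ge0.
- by move=> z _; rewrite lee_fin sqr_ge0.
- by apply: filterS fg => z /= h /h ->.
Qed.

Lemma Rintegral_ae f g : measurable_fun D f -> measurable_fun D g ->
  {ae mu, forall z, D z -> f z = g z} ->
  \int[mu]_(z in D) f z = \int[mu]_(z in D) g z.
Proof.
move=> mf mg fg; congr fine; apply: ae_eq_integral => //;
  [exact/measurable_EFinP|exact/measurable_EFinP|].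
by apply: filterS fg => z /= h /h ->.
Qed.

Lemma dot_ae f f' g g' : L2 f -> L2 f' -> L2 g -> L2 g' ->
  {ae mu, forall z, D z -> f z = f' z} -> {ae mu, forall z, D z -> g z = g' z} ->
  dot f g = dot f' g'.
Proof.
move=> [mf _] [mf' _] [mg _] [mg' _] ff' gg'.
apply: Rintegral_ae; [exact: measurable_funM|exact: measurable_funM|].
by apply: filterS2 ff' gg' => z /= h1 h2 Dz; rewrite h1// h2.
Qed.

Lemma integrable_cst (c : R) : (mu D < +oo)%E -> mu.-integrable D (EFin \o cst c).
Proof.
move=> Dy; apply/integrableP; split; first exact/measurable_EFinP/measurable_cst.
by rewrite [ltLHS](integral_cst mu mD `|c|%:E) lte_mul_pinfty.
Qed.

Lemma L2_cst c : (mu D < +oo)%E -> L2 (cst c).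
Proof.
move=> Dy; split; first exact: measurable_cst.
exact: (integrable_cst (c ^+ 2)).
Qed.

Lemma L2_bounded f M : (mu D < +oo)%E -> measurable_fun D f ->
  (forall z, D z -> `|f z| <= M) -> L2 f.
Proof.
move=> Dy mf fM; split => //.
apply: (@integrable_bound _ (cst (M ^+ 2))); first exact: measurable_funX.
  exact: integrable_cst.
move=> z Dz /=; rewrite normrX lerXn2r ?nnegrE//; last exact: fM.
exact: le_trans (fM _ Dz).
Qed.

Lemma L2_bounded_mul f g M : measurable_fun D f -> (forall z, D z -> `|f z| <= M) -> L2 g ->
  L2 (fun z => f z * g z).
Proof.
move=> mf fM [mg g2]; split; first exact: measurable_funM.
apply: (@integrable_bound _ (fun z => M ^+ 2 * g z ^+ 2)).
- by apply: measurable_funX; exact: measurable_funM.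
- exact: (integrableZl mD (M ^+ 2) g2).
- move=> z Dz /=; rewrite exprMn normrM !normrX (real_normK (num_real (g z))).
  rewrite ler_wpM2r ?sqr_ge0// lerXn2r ?nnegrE//; last exact: fM.
  exact: le_trans (fM _ Dz).
Qed.

Lemma L2_integrable f : (mu D < +oo)%E -> L2 f -> mu.-integrable D (EFin \o f).
Proof.
move=> Dy Hf; have := L2_integrableM Hf (L2_cst 1 Dy).
by apply: eq_integrable => // z _ /=; rewrite mulr1.
Qed.

Definition L2cvg (f_ : nat -> T -> R) f :=
  dot (comb (f_ n) (-1) f) (comb (f_ n) (-1) f) @[n --> \oo] --> 0.

Lemma L2cvg_dot (f_ : nat -> T -> R) f h : (forall n, L2 (f_ n)) -> L2 f -> L2 h -> L2cvg f_ f ->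
  dot (f_ n) h @[n --> \oo] --> dot f h.
Proof.
move=> Hf_ Hf Hh cf.
have cs n : `|dot f h - dot (f_ n) h| <=
    Num.sqrt (dot (comb (f_ n) (-1) f) (comb (f_ n) (-1) f) * dot h h).
  rewrite distrC -sqrtr_sqr ler_wsqrtr//.
  by have := dot_cauchy_schwarz (L2_comb (-1) (Hf_ n) Hf) Hh; rewrite dot_comb// mulN1r.
apply/cvgrPdist_le => e e0.
have /cvgrPdist_le c0 : Num.sqrt (dot (comb (f_ n) (-1) f) (comb (f_ n) (-1) f) * dot h h)
   @[n --> \oo] --> (0:R).
  rewrite -[X in _ --> X]sqrtr0 -(mul0r (dot h h)).
  apply: (continuous_cvg _ (@sqrt_continuous R _)).
  by apply: cvgMl.
apply: filterS (c0 _ e0) => n; rewrite sub0r normrN ger0_norm ?sqrtr_ge0//.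
exact: le_trans (cs n).
Qed.

End L2.

Section L2_complete.
Context d (T : measurableType d) (R : realType).
Variables (mu : {measure set T -> \bar R}) (D : set T).
Hypotheses (mD : measurable D) (Dy : (mu D < +oo)%E).
Local Notation L2 := (L2 mu D).
Local Notation dot := (dot mu D).

(** Fatou's lemma for the squares: the norm is lower semicontinuous under
    almost everywhere convergence. *)
Lemma L2_fatou (F_ : nat -> T -> R) (F : T -> R) (C : R) : (forall k, L2 (F_ k)) ->
  measurable_fun D F -> {ae mu, forall z, D z -> F_ ^~ z @ \oo --> F z} ->
  (\forall k \near \oo, dot (F_ k) (F_ k) <= C) -> L2 F /\ dot F F <= C.
Proof.
move=> HF_ mF F_F FC.
have mF2 k : measurable_fun D (fun z => (F_ k z ^+ 2)%:E).
  by apply/measurable_EFinP; apply: measurable_funX; exact: (HF_ k).1.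
have F2C : (\int[mu]_(z in D) (F z ^+ 2)%:E <= C%:E)%E.
  rewrite (@ge0_ae_eq_integral _ _ _ _ _ _ (fun z => limn_einf (fun k => (F_ k z ^+ 2)%:E)))//.
  - apply: le_trans (fatou mu mD mF2 _) _.
      by move=> k z _; rewrite lee_fin sqr_ge0.
    rewrite limn_einf_lim; apply: lime_le; first exact: is_cvg_einfs.
    case: FC => N _ FC; apply: nearW => n.
    apply: (@le_trans _ _ (\int[mu]_(z in D) (F_ (n + N)%N z ^+ 2)%:E)%E).
      by apply: ereal_inf_lbound; exists (n + N)%N => //=; rewrite leq_addr.
    by rewrite -dotE// lee_fin; apply: FC => /=; rewrite leq_addl.
  - by apply/measurable_EFinP; exact: measurable_funX.
  - rewrite (_ : (fun z => _) = (fun z => - limn_esup (fun k => - (F_ k z ^+ 2)%:E))%E)//.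
    apply: measurableT_comp => //; apply: measurable_fun_limn_esup => k.
    exact: measurableT_comp.
  - by move=> z _; rewrite lee_fin sqr_ge0.
  - move=> z _; rewrite limn_einf_lim; apply: lime_ge; first exact: is_cvg_einfs.
    by apply: nearW => n; apply: le_ereal_inf_tmp => _ [k _ <-]; rewrite lee_fin sqr_ge0.
  - apply: filterS F_F => z /= h /h{}h; apply/esym.
    apply: (cvg_limn_einf_sup _).1; apply/cvg_EFin; first exact: nearW.
    by rewrite /comp /=; apply: cvgM.
have HF : L2 F by apply: L2_lty => //; rewrite (le_lt_trans F2C)// ltry.
by split=> //; rewrite -lee_fin dotE.
Qed.

(** Riesz-Fischer.  Along a fast subsequence the increments are summable in
    L^1, the measure being finite; so their sum is finite almost everywhere and
    the subsequence converges there.  Lower semicontinuity of the norm then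
    turns the Cauchy property into norm convergence of the whole sequence.  The
    subsequence is part of the conclusion because almost everywhere convergence
    identifies the limit of the products with a fixed function. *)
Lemma L2_complete (f_ : nat -> T -> R) : (forall n, L2 (f_ n)) ->
  (forall eps : R, 0 < eps -> exists N, forall m n, (N <= m)%N -> (N <= n)%N ->
     dot (comb (f_ m) (-1) (f_ n)) (comb (f_ m) (-1) (f_ n)) <= eps) ->
  exists g, [/\ L2 g, L2cvg mu D f_ g &
    exists2 sigma : nat -> nat, (forall n, (n <= sigma n)%N) &
      {ae mu, forall z, D z -> f_ (sigma n) z @[n --> \oo] --> g z}].
Proof.
move=> Hf_ cf.
have /choice[N NP] k : exists N, forall m n, (N <= m)%N -> (N <= n)%N ->
    dot (comb (f_ m) (-1) (f_ n)) (comb (f_ m) (-1) (f_ n)) <= (2^-1 ^+ k) ^+ 2.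
  by apply: cf; rewrite !exprn_gt0.
(* beyond N i for every i <= k, and cofinal thanks to the summand k *)
pose sigma k := (k + \sum_(j < k.+1) N j)%N.
have sigma_N i k : (i <= k)%N -> (N i <= sigma k)%N.
  move=> ik; rewrite /sigma (bigD1 (inord i : 'I_k.+1))//= inordK ?ltnS//.
  by rewrite addnCA leq_addr.
have sigma_id k : (k <= sigma k)%N by rewrite leq_addr.
pose d_ k := comb (f_ (sigma k.+1)) (-1) (f_ (sigma k)).
have Hd_ k : L2 (d_ k) by exact: L2_comb.
have Hn k : L2 (fun z => `|d_ k z|).
  apply: L2_lty => //; first by apply: measurableT_comp => //; exact: (Hd_ k).1.
  under eq_integral do rewrite real_normK ?num_real//.
  by rewrite -dotE// ltry.
have dn k : dot (fun z => `|d_ k z|) (fun z => `|d_ k z|) <= (2^-1 ^+ k) ^+ 2.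
  have -> : dot (fun z => `|d_ k z|) (fun z => `|d_ k z|) = dot (d_ k) (d_ k).
    by apply: eq_Rintegral => z _; rewrite -expr2 real_normK ?num_real.
  by apply: NP; exact: sigma_N.
pose C := Num.sqrt (dot (cst 1) (cst 1)).
have H1 : L2 (cst 1) by exact: L2_cst.
have intd k : (\int[mu]_(z in D) `|d_ k z|%:E <= (C * 2^-1 ^+ k)%:E)%E.
  have i1 := L2_integrable mD Dy (Hn k).
  rewrite -[leLHS](fineK (integrable_fin_num mD i1)) lee_fin.
  have -> : fine (\int[mu]_(z in D) `|d_ k z|%:E) = dot (fun z => `|d_ k z|) (cst 1).
    by congr fine; apply: eq_integral => z _ /=; rewrite mulr1.
  rewrite /C -[X in _ * X]ger0_norm ?exprn_ge0// -sqrtr_sqr -sqrtrM ?dot_ge0//.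
  apply: le_trans (ler_norm _) _; rewrite -sqrtr_sqr ler_wsqrtr//.
  apply: le_trans (dot_cauchy_schwarz mD (Hn k) H1) _.
  by rewrite mulrC ler_wpM2l ?dot_ge0.
have intS : (\int[mu]_(z in D) (\sum_(k <oo) `|d_ k z|%:E) < +oo)%E.
  rewrite integral_nneseries//; last first.
    by move=> k; apply/measurable_EFinP; exact: (Hn k).1.
  apply: (@le_lt_trans _ _ (C * 2)%:E); last exact: ltry.
  apply: lime_le; first by apply: is_cvg_nneseries => k _ _; exact: integral_ge0.
  apply: nearW => n.
  apply: (@le_trans _ _ (\sum_(0 <= k < n) (C * 2^-1 ^+ k)%:E)%E); first exact: lee_sum.
  rewrite sumEFin lee_fin -mulr_sumr ler_wpM2l ?sqrtr_ge0//.
  have -> : \sum_(0 <= k < n) 2^-1 ^+ k = 2 - 2 * 2^-1 ^+ n :> R.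
    elim: n => [|n IH]; first by rewrite big_geq// expr0; ring.
    by rewrite big_nat_recr//= IH exprS; field.
  by rewrite lerBlDr lerDl mulr_ge0// exprn_ge0.
have mS : measurable_fun D (fun z => \sum_(k <oo) `|d_ k z|%:E)%E.
  apply: ge0_emeasurable_sum => //.
  by move=> k _; apply/measurable_EFinP; exact: (Hn k).1.
have iS : mu.-integrable D (fun z => \sum_(k <oo) `|d_ k z|%:E)%E.
  apply/integrableP; split => //.
  rewrite (eq_integral (fun z => \sum_(k <oo) `|d_ k z|%:E)%E)// => z _.
  by rewrite gee0_abs// nneseries_ge0.
have aecvg : {ae mu, forall z, D z -> cvgn (fun n => f_ (sigma n) z)}.
  apply: filterS (integrable_ae mD iS) => z /= h /h{h} fS.
  suff : cvgn (series (fun k => d_ k z)).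
    move=> cS; have -> : (fun n => f_ (sigma n) z) =
        (fun n => f_ (sigma 0%N) z + series (fun k => d_ k z) n).
      apply/funext => n; rewrite (eq_sum_telescope (fun n => f_ (sigma n) z) n).
      by congr (_ + series _ n); apply/funext => k; rewrite /telescope /= /d_ /comb mulN1r.
    by apply: is_cvgD => //; exact: is_cvg_cst.
  apply: normed_cvg; apply: nondecreasing_is_cvgn.
    by apply: nondecreasing_series => k _ /=.
  exists (fine (\sum_(k <oo) `|d_ k z|%:E)%E) => _ [n _ <-].
  rewrite -lee_fin fineK// /series /= -sumEFin.
  exact: nneseries_lim_ge.
(* measurable on the whole of D, and equal to the limit wherever there is one *)
pose g z := fine (limn_esup (fun n => (f_ (sigma n) z)%:E)).
have mg : measurable_fun D g.
  apply: measurableT_comp => //; apply: measurable_fun_limn_esup => n.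
  by apply/measurable_EFinP; exact: (Hf_ _).1.
have aeg : {ae mu, forall z, D z -> f_ (sigma n) z @[n --> \oo] --> g z}.
  apply: filterS aecvg => z /= h /h{h} /cvg_ex[l fl].
  suff -> : g z = l by [].
  rewrite /g; have /cvg_limn_einf_sup[_ ->] // : (f_ (sigma n) z)%:E @[n --> \oo] --> l%:E.
  by apply/cvg_EFin => //; exact: nearW.
have gf n (e : R) : (\forall k \near \oo, dot (comb (f_ (sigma k)) (-1) (f_ n))
    (comb (f_ (sigma k)) (-1) (f_ n)) <= e) ->
    L2 (comb g (-1) (f_ n)) /\ dot (comb g (-1) (f_ n)) (comb g (-1) (f_ n)) <= e.
  move=> he; apply: (@L2_fatou (fun k => comb (f_ (sigma k)) (-1) (f_ n))) => //.
  - by move=> k; exact: L2_comb.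
  - by apply: measurable_funD => //; apply: measurable_funM => //; exact: (Hf_ n).1.
  - apply: filterS aeg => z /= h /h{}h; apply: cvgD => //; exact: cvg_cst.
have Hg : L2 g.
  have [K KP] := cf 1 ltr01.
  have [|H _] := gf K 1; first by exists K => // k /= Kk; apply: KP => //; exact: leq_trans (sigma_id k).
  have := L2_comb mD 1 H (Hf_ K).
  by congr L2; apply/funext => z; rewrite /comb; ring.
exists g; split => //; last by exists sigma.
apply/cvgrPdist_le => e e0; have [K KP] := cf e e0; exists K => // n /= Kn.
rewrite sub0r normrN ger0_norm ?dot_ge0//; last exact: L2_comb.
have [|_] := gf n e; first by exists K => // k /= Kk; apply: KP => //; exact: leq_trans (sigma_id k).
apply: le_trans; rewrite le_eqVlt; apply/orP; left; apply/eqP.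
by apply: eq_Rintegral => z _; rewrite /comb; ring.
Qed.

End L2_complete.

Section L2_operators.
Context d (T : measurableType d) (R : realType).
Variables (mu : {measure set T -> \bar R}) (D : set T).
Hypothesis mD : measurable D.
Implicit Types (u v f g : T -> R).

(** An operator that chooses representatives, such as the weak derivative, is
    linear only up to null sets. *)
Definition ae_linear (H : set (T -> R)) (A : (T -> R) -> T -> R) :=
  (forall u, H u -> L2 mu D (A u)) /\
  forall u t v, H u -> H v ->
    {ae mu, forall z, D z -> A (comb u t v) z = comb (A u) t (A v) z}.

Lemma psd_pullback (H : set (T -> R)) (A : (T -> R) -> T -> R) :
  (forall u t v, H u -> H v -> H (comb u t v)) -> ae_linear H A ->
  psd_form H (fun u v => dot mu D (A u) (A v)).
Proof.
move=> cH [LA lA]; split => //.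
- by move=> u v _ _; exact: dot_sym.
- move=> u t v w Hu Hv Hw; rewrite -dot_comb//; [|exact: LA..].
  apply: (dot_ae mD); [exact/LA/cH|apply: L2_comb => //; exact: LA|exact: LA|exact: LA|exact: lA|].
  exact: aeW.
- by move=> u Hu; apply: dot_ge0 => //; exact: LA.
Qed.

Lemma dist_comb (H : set (T -> R)) (A : (T -> R) -> T -> R) u v :
  (forall u t v, H u -> H v -> H (comb u t v)) -> ae_linear H A -> H u -> H v ->
  dot mu D (A (comb u (-1) v)) (A (comb u (-1) v)) =
  dot mu D (comb (A u) (-1) (A v)) (comb (A u) (-1) (A v)).
Proof.
move=> cH [LA lA] Hu Hv; apply: (dot_ae mD); try exact: lA.
- exact/LA/cH.
- by apply: L2_comb => //; exact: LA.
- exact/LA/cH.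
- by apply: L2_comb => //; exact: LA.
Qed.

Lemma dist_sym u v : dot mu D (comb u (-1) v) (comb u (-1) v) =
  dot mu D (comb v (-1) u) (comb v (-1) u).
Proof. by apply: eq_Rintegral => z _; rewrite /comb; ring. Qed.

Lemma L2cvg_ae (f_ : nat -> T -> R) f g : (forall n, L2 mu D (f_ n)) -> L2 mu D f -> L2 mu D g ->
  {ae mu, forall z, D z -> f z = g z} -> L2cvg mu D f_ f -> L2cvg mu D f_ g.
Proof.
move=> Hf_ Hf Hg fg; rewrite /L2cvg.
rewrite (_ : (fun n => dot mu D (comb (f_ n) (-1) f) (comb (f_ n) (-1) f)) =
  (fun n => dot mu D (comb (f_ n) (-1) g) (comb (f_ n) (-1) g)))//.
apply/funext => n; apply: (dot_ae mD); try exact: L2_comb.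
- by apply: filterS fg => z h /h; rewrite /comb => ->.
- by apply: filterS fg => z h /h; rewrite /comb => ->.
Qed.

Lemma L2cvg_le (f_ : nat -> T -> R) f : L2cvg mu D f_ f -> (forall n, L2 mu D (f_ n)) -> L2 mu D f ->
  forall eps : R, 0 < eps -> exists N, forall n, (N <= n)%N ->
    dot mu D (comb f (-1) (f_ n)) (comb f (-1) (f_ n)) <= eps.
Proof.
move=> /cvgrPdist_le cf Hf_ Hf eps /cf[N _ NP]; exists N => n Nn.
have := NP n Nn; rewrite sub0r normrN dist_sym ger0_norm//.
by apply: dot_ge0 => //; exact: L2_comb.
Qed.

End L2_operators.

(** * Measurability in the plane and the spaces on the unit square *)

Section plane.
Context {R : realType}.
Implicit Types (f g u v w : R * R -> R).
Local Notation plane := (measurableTypeR R * measurableTypeR R)%type.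

Lemma rat_near (x e : R) : 0 < e -> exists q : rat, `|x - ratr q| < e.
Proof.
move=> e0; have [q] : exists q : rat, ratr q \in `]x - e, x + e[.
  by apply: rat_in_itvoo; lra.
by rewrite in_itv /= => /andP[h1 h2]; exists q; rewrite ltr_norml; apply/andP; split; lra.
Qed.

(** The squares with rational centre and radius [1 / (n + 1)] form a countable
    base of the plane. *)
Lemma open_measurable2 (U : set (R * R)) : open U -> measurable (U : set plane).
Proof.
move=> oU.
pose B (t : (rat * rat) * nat) : set plane :=
  ball (ratr t.1.1 : R) t.2.+1%:R^-1 `*` ball (ratr t.1.2 : R) t.2.+1%:R^-1.
have mB t : measurable (B t).
  by apply: measurableX; apply: open_measurable; exact: ball_open.
rewrite (_ : U = \bigcup_t (if `[< B t `<=` U >] then B t else set0)); last first.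
  apply/seteqP; split => [z Uz|z [t _]]; last by case: ifPn => // /asboolP; apply.
  have /nbhs_ballP[r /= r0 rU] := open_nbhs_nbhs (conj oU Uz).
  have [n nr] : exists n : nat, 2 * n.+1%:R^-1 <= r.
    exists (Num.truncn (2 / r)); rewrite mulrC ler_pdivrMl// -ler_pdivrMr//.
    by apply/ltW/truncnS_gt.
  have n0 : 0 < n.+1%:R^-1 :> R by rewrite invr_gt0.
  have [p pP] := rat_near z.1 n0; have [q qP] := rat_near z.2 n0.
  exists ((p, q), n) => //; rewrite ifT; last first.
    apply/asboolP => z' [/= h1 h2]; apply: rU; split => /=.
      apply: (le_ball nr); rewrite mulr2n mulrDl mul1r.
      move: h1; rewrite -!ball_normE /ball_ /= => h1.
      by apply: le_lt_trans (ler_distD (ratr p) _ _) _; exact: ltrD.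
    apply: (le_ball nr); rewrite mulr2n mulrDl mul1r.
    move: h2; rewrite -!ball_normE /ball_ /= => h2.
      by apply: le_lt_trans (ler_distD (ratr q) _ _) _; exact: ltrD.
  by split; apply: ball_sym.
apply: countable_bigcupT_measurable => // t.
by case: ifPn.
Qed.

Lemma closed_measurable2 (U : set (R * R)) : closed U -> measurable (U : set plane).
Proof. by move/closed_openC/open_measurable2/measurableC; rewrite setCK. Qed.

Lemma compact_measurable2 (U : set (R * R)) : compact U -> measurable (U : set plane).
Proof.
by move/compact_closed => /(_ (@norm_hausdorff _ _)); exact: closed_measurable2.
Qed.

Lemma continuous_measurable2 (f : R * R -> R) : continuous f ->
  measurable_fun (setT : set plane) f.
Proof.
move=> /continuousP cf; apply: (measurability _ (RGenOInfty.measurableE R)).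
move=> _ [_ [a ->] <-]; rewrite setTI; apply: open_measurable2; apply: cf.
exact: rray_open.
Qed.

Lemma measurable_Omega : measurable (Omega : set plane).
Proof. by apply: measurableX; exact: measurable_itv. Qed.

Lemma leb2_Omega : leb2 (@Omega R) = 1%E.
Proof.
apply: etrans (product_measure1E lebesgue_measure lebesgue_measure _ _) _;
  [exact: measurable_itv..|].
by rewrite /= lebesgue_measure_itv /= lte_fin ltr01 sube0 mule1.
Qed.

Lemma leb2_Omega_lty : (leb2 (@Omega R) < +oo)%E.
Proof. by rewrite leb2_Omega ltry. Qed.

Local Notation L2O := (L2 (@leb2 R) Omega).
Local Notation dotO := (dot (@leb2 R) Omega).

Lemma measurable_Omega_patch f :
  measurable_fun (setT : set plane) (f \_ Omega) -> measurable_fun (Omega : set plane) f.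
Proof. by move/(measurable_restrictT _ measurable_Omega). Qed.

Lemma Lp_measurable p f : Lp p f -> measurable_fun (Omega : set plane) f.
Proof.
move=> /sub_Lfun_mfun; rewrite inE => mf.
exact: measurable_Omega_patch.
Qed.

Lemma integral_sqr_patch f :
  (\int[leb2]_z `|(EFin \o (f \_ Omega)) z| `^ 2 = \int[leb2]_(z in Omega) (f z ^+ 2)%:E)%E.
Proof.
rewrite [RHS]integral_mkcond; apply: eq_integral => z _ /=.
rewrite !patchE; case: ifPn => _; last by rewrite normr0 powR0.
by rewrite powR_mulrn// real_normK ?num_real.
Qed.

(** For the exponent 2, the Lp norm of the function cut off outside [Omega] is
    expressed by the integral of the square over [Omega]. *)
Lemma Lp2P f : Lp 2 f <-> L2O f.
Proof.
split=> [Hf|[mf f2]].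
  apply: L2_lty; first exact: Lp_measurable Hf.
  rewrite -integral_sqr_patch -poweR_Lnorm//.
  by apply: poweR_lty; have := sub_Lfun_finLfun Hf; rewrite inE.
rewrite /Lp /= inE; apply/andP; split.
  by rewrite inE; apply/(measurable_restrictT _ measurable_Omega).
rewrite inE /= /finite_norm; apply: (@lty_poweRy _ _ 2) => //.
rewrite poweR_Lnorm// integral_sqr_patch.
by rewrite -dotE ?ltry//; exact: measurable_Omega.
Qed.

Lemma Lp_norm2 f : L2O f -> Lp_norm 2 f ^+ 2 = dotO f f.
Proof.
move=> Hf; apply: EFin_inj; rewrite dotE//; last exact: measurable_Omega.
rewrite -integral_sqr_patch -poweR_Lnorm// /Lp_norm.
have : (0 <= 'N[leb2]_2%:E[(EFin \o (f \_ Omega))])%E by exact: Lnorm_ge0.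
have : ('N[leb2]_2%:E[(EFin \o (f \_ Omega))] < +oo)%E.
  by have /Lp2P/sub_Lfun_finLfun := Hf; rewrite inE.
by case: ('N[leb2]_2%:E[_])%E => // r _ r0; rewrite /= powR_mulrn.
Qed.

End plane.

(** * Smooth functions with compact support *)

Section flat_function.
Context {R : realType}.
Implicit Types (q P : {poly R}) (k : nat) (x : R).

(** [P q^-k exp(-1/q)] where [q] is positive, and 0 elsewhere.  This family is
    stable under differentiation, at the price of [k + 2] in place of [k], so
    that all its members are smooth. *)
Definition flat q P k : R -> R := fun x =>
  if 0 < q.[x] then P.[x] * q.[x]^-1 ^+ k * expR (- q.[x]^-1) else 0.

Definition flat_deriv q P k : {poly R} :=
  (P^`() * q ^+ 2 - k%:R *: (P * q^`() * q) + P * q^`())%R.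

(** Settles differentiability at the zeros of [q], where the formula for
    [flat] changes. *)
Lemma is_derive0_dominated (h g : R -> R) x : h x = 0 -> g x = 0 ->
  (forall y, `|h y| <= `|g y|) -> is_derive x 1 g 0 -> is_derive x 1 h 0.
Proof.
move=> hx gx hg [dg g0].
have cg : (fun t => t^-1 *: ((g \o shift x) (t *: 1) - g x)) @ 0^' --> (0 : R).
  by rewrite -[X in _ --> X]g0; exact: dg.
have ch : (fun t => t^-1 *: ((h \o shift x) (t *: 1) - h x)) @ 0^' --> (0 : R).
  apply/cvgrPdist_le => e e0; move/cvgrPdist_le : cg => /(_ _ e0).
  apply: filterS => t; rewrite !sub0r !normrN hx gx !subr0 !normrZ.
  by apply: le_trans; rewrite ler_wpM2l//; exact: hg.
by apply: DeriveDef; [apply/cvg_ex; exists 0|exact: cvg_lim].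
Qed.

(** Since [exp(1/q) >= q^-(k+2) / (k+2)!], the exponential absorbs [q^-k] and
    leaves a factor [q^2], whose derivative vanishes at the zeros of [q]. *)
Lemma flat_dominated q P k x :
  `|flat q P k x| <= `|((k.+2)`!%:R *: (P * q ^+ 2)).[x]|.
Proof.
rewrite /flat; case: ifPn => q0; last by rewrite normr0.
have -> : ((k.+2)`!%:R *: (P * q ^+ 2)).[x] = P.[x] * ((k.+2)`!%:R * q.[x] ^+ 2).
  by rewrite hornerZ hornerM horner_exp; ring.
rewrite -mulrA normrM [leRHS]normrM ler_wpM2l//.
have q0W := ltW q0.
rewrite ger0_norm ?mulr_ge0 ?expR_ge0 ?exprn_ge0 ?invr_ge0//.
rewrite ger0_norm ?mulr_ge0 ?sqr_ge0//.
have := expR_ge1Dxn k.+1 (ltW (ltac:(by rewrite invr_gt0) : 0 < q.[x]^-1)).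
move: (q.[x]) q0 => t t0 h.
have {}h : (t^-1) ^+ k.+2 / (k.+2)`!%:R <= expR t^-1 by apply: le_trans h; lra.
have f0 : 0 < (k.+2)`!%:R :> R by rewrite ltr0n fact_gt0.
rewrite expRN ler_pdivrMr ?expR_gt0//.
have -> : t^-1 ^+ k = (k.+2)`!%:R * t ^+ 2 * (t^-1 ^+ k.+2 / (k.+2)`!%:R).
  by rewrite !exprS; field; rewrite !gt_eqF.
by rewrite ler_wpM2l// mulr_ge0 ?sqr_ge0// ltW.
Qed.

Lemma is_derive_flat q P k x :
  is_derive x 1 (flat q P k) (flat q (flat_deriv q P k) k.+2 x).
Proof.
have [q0|q0|q0] := ltgtP q.[x] 0.
- rewrite [X in is_derive _ _ _ X](_ : _ = 0); last by rewrite /flat lt_gtF.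
  apply: (@near_eq_is_derive _ _ _ (cst 0)).
  have /cvgr_lt := @continuous_horner _ q x.
  by move=> /(_ _ q0); apply: filterS => y qy; rewrite /flat lt_gtF.
- have dq := is_derive_poly q x.
  rewrite [X in is_derive _ _ _ X](_ : _ =
     (flat_deriv q P k).[x] * q.[x]^-1 ^+ k.+2 * expR (- q.[x]^-1)); last first.
    by rewrite /flat q0.
  have dr : is_derive x 1 (fun y => q.[y]^-1) (- q.[x]^-1 ^+ 2 * q^`().[x]).
    apply: is_derive_eq; first by apply: is_deriveV; rewrite ?gt_eqF.
    by rewrite -exprVn.
  have dE : is_derive x 1 (expR \o (fun y => - q.[y]^-1))
      (expR (- q.[x]^-1) * (q.[x]^-1 ^+ 2 * q^`().[x])).
    apply: is_derive1_comp; apply: (is_derive_eq (is_deriveN dr)).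
    by rewrite mulNr opprK.
  apply: (@near_eq_is_derive _ _ _
    ((horner P * (fun y => q.[y]^-1) ^+ k) * (expR \o (fun y => - q.[y]^-1)))).
    have /cvgr_gt := @continuous_horner _ q x.
    by move=> /(_ _ q0); apply: filterS => y qy; rewrite /flat qy /= !fctE.
  apply: is_derive_eq; rewrite /flat_deriv !fctE /= !(hornerD, hornerN, hornerZ, hornerM, horner_exp).
  case: k => [|k]; rewrite ?exprS ?expr0/=; rewrite /GRing.scale /=; field; by rewrite gt_eqF.
- rewrite [X in is_derive _ _ _ X](_ : _ = 0); last by rewrite /flat q0 ltxx.
  apply: (@is_derive0_dominated _ (horner ((k.+2)`!%:R *: (P * q ^+ 2)))).
  + by rewrite /flat q0 ltxx.
  + by rewrite hornerZ hornerM horner_exp q0; ring.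
  + exact: flat_dominated.
  + apply: is_derive_eq; rewrite derivZ derivM deriv_exp !(hornerZ, hornerD, hornerM, hornerMn, horner_exp) q0; ring.
Qed.

Lemma flat_continuous q P k : continuous (flat q P k).
Proof.
move=> x; have [d _] := is_derive_flat q P k x.
exact/differentiable_continuous/derivable1_diffP.
Qed.

End flat_function.

Section partial_derivatives.
Context {R : realType}.
Implicit Types (phi : R * R -> R) (z : R * R).

Lemma ex_growth phi z :
  (fun t : R => t^-1 *: ((phi \o shift z) (t *: ex) - phi z)) =
  (fun t : R => t^-1 *: (((fun s => phi (s, z.2)) \o shift z.1) (t *: 1) - phi (z.1, z.2))).
Proof.
apply/funext => t; case: z => x y /=; congr (_ *: (phi _ - _)).
by rewrite /ex /shift /=; congr pair; rewrite /= /GRing.scale /= ?mulr0 ?add0r.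
Qed.

Lemma ey_growth phi z :
  (fun t : R => t^-1 *: ((phi \o shift z) (t *: ey) - phi z)) =
  (fun t : R => t^-1 *: (((fun s => phi (z.1, s)) \o shift z.2) (t *: 1) - phi (z.1, z.2))).
Proof.
apply/funext => t; case: z => x y /=; congr (_ *: (phi _ - _)).
by rewrite /ey /shift /=; congr pair; rewrite /= /GRing.scale /= ?mulr0 ?add0r.
Qed.

Lemma is_derive_ex phi z l :
  is_derive z ex phi l <-> is_derive z.1 1 (fun s => phi (s, z.2)) l.
Proof.
split=> -[d e]; split.
- by move: d; rewrite /derivable ex_growth.
- by rewrite -e /derive ex_growth.
- by rewrite /derivable ex_growth.
- by rewrite -e /derive ex_growth.
Qed.

Lemma is_derive_ey phi z l :
  is_derive z ey phi l <-> is_derive z.2 1 (fun s => phi (z.1, s)) l.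
Proof.
split=> -[d e]; split.
- by move: d; rewrite /derivable ey_growth.
- by rewrite -e /derive ey_growth.
- by rewrite /derivable ey_growth.
- by rewrite -e /derive ey_growth.
Qed.

Definition tensor (g h : R -> R) : R * R -> R := fun z => g z.1 * h z.2.

Lemma tensor_continuous g h : continuous g -> continuous h -> continuous (tensor g h).
Proof.
move=> cg ch z; apply: cvgM.
  by apply: (@continuous_comp _ _ _ fst g); [exact: cvg_fst|exact: cg].
by apply: (@continuous_comp _ _ _ snd h); [exact: cvg_snd|exact: ch].
Qed.

Lemma is_derive_tensor_ex (g h g' : R -> R) z :
  (forall x : R, is_derive x 1 g (g' x)) -> is_derive z ex (tensor g h) (tensor g' h z).
Proof.
move=> dg; apply/is_derive_ex; rewrite /tensor /=.
have := dg z.1 => dgz.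
rewrite [X in is_derive _ _ X](_ : _ = g * cst (h z.2)); last by apply/funext => s.
by apply: is_derive_eq; rewrite /= scaler0 add0r /GRing.scale /= mulrC.
Qed.

Lemma is_derive_tensor_ey (g h h' : R -> R) z :
  (forall x : R, is_derive x 1 h (h' x)) -> is_derive z ey (tensor g h) (tensor g h' z).
Proof.
move=> dh; apply/is_derive_ey; rewrite /tensor /=.
have := dh z.2 => dhz.
rewrite [X in is_derive _ _ X](_ : _ = cst (g z.1) * h); last by apply/funext => s.
by apply: is_derive_eq; rewrite /= scaler0 addr0.
Qed.

(** Every iterated partial derivative is again a tensor product of two flat
    functions. *)
Lemma smooth_tensor_flat q1 P1 k1 q2 P2 k2 :
  smooth (tensor (flat q1 P1 k1) (flat q2 P2 k2) : R * R -> R).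
Proof.
move=> s; suff H : {subset s <= [:: ex; ey]} -> exists P1' k1' P2' k2',
    partials s (tensor (flat q1 P1 k1) (flat q2 P2 k2)) =
    tensor (flat q1 P1' k1') (flat q2 P2' k2').
  move=> /H[P1' [k1' [P2' [k2' ->]]]]; split.
    by apply: tensor_continuous; exact: flat_continuous.
  move=> z; split; apply: ex_derive.
    by apply: is_derive_tensor_ex => x; exact: is_derive_flat.
  by apply: is_derive_tensor_ey => x; exact: is_derive_flat.
elim: s => [|e s IH] sub; first by exists P1, k1, P2, k2.
have [|P1' [k1' [P2' [k2' /= ->]]]] := IH.
  by move=> e' e's; apply: sub; rewrite inE e's orbT.
have := sub e (mem_head _ _); rewrite !inE => /orP[] /eqP ->.
  exists (flat_deriv q1 P1' k1'), k1'.+2, P2', k2'; apply/funext => z.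
  apply: derive_val; apply: is_derive_tensor_ex => x; exact: is_derive_flat.
exists P1', k1', (flat_deriv q2 P2' k2'), k2'.+2; apply/funext => z.
apply: derive_val; apply: is_derive_tensor_ey => x; exact: is_derive_flat.
Qed.

End partial_derivatives.

(** * The fundamental lemma of the calculus of variations *)

Section vanishing_integrals.
Context {R : realType}.

(** The sets over whose preimage [W] integrates to 0 form a Dynkin class.
    Going through a map [f] allows treating one coordinate at a time. *)
Lemma integral0_preimage d d' (T : measurableType d) (T' : measurableType d')
    (mu : {measure set T -> \bar R}) (W : T -> \bar R) (f : T -> T') (G : set (set T')) :
  measurable_fun setT f -> mu.-integrable setT W ->
  @measurable _ T' = <<s G >> -> setI_closed G ->
  (\int[mu]_x W x = 0)%E ->
  (forall A, G A -> (\int[mu]_(x in f @^-1` A) W x = 0)%E) ->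
  forall A, measurable A -> (\int[mu]_(x in f @^-1` A) W x = 0)%E.
Proof.
move=> mf iW GE GI W0 GW A mA.
have mpre B : measurable B -> measurable (f @^-1` B).
  by move=> mB; rewrite -[X in measurable X]setTI; exact: mf.
apply: (@dynkin_induction _ _ G (fun A => (\int[mu]_(x in f @^-1` A) W x = 0)%E)) => //.
- by move=> B mB B0; have := W0;
    rewrite -(setUv (f @^-1` B)) integral_setU ?B0 ?add0e//;
    [exact: mpre|exact/measurableC/mpre|rewrite setUv; exact: measurable_int iW|
     exact/disj_setPCl].
- move=> F mF tF F0; rewrite preimage_bigcup integral_bigcup.
  + by rewrite eseries0// => k _ _; exact: F0.
  + by apply/trivIsetP => i j _ _ ij; rewrite -preimage_setI (trivIsetP.1 tF)// preimage_set0.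
  + by move=> k; exact: mpre.
  + apply: integrableS iW => //; apply: bigcupT_measurable => k; exact: mpre.
- by rewrite -GE.
Qed.

End vanishing_integrals.

Section square.
Context {R : realType}.
Local Notation plane := (measurableTypeR R * measurableTypeR R)%type.
Local Notation mu := (@leb2 R).

Lemma setI_closed_itvoo : setI_closed (@RGenOpens.G R).
Proof.
move=> _ _ [a [b ->]] [c [d ->]]; exists (Num.max a c), (Num.min b d).
apply/seteqP; split => x /=; rewrite !in_itv /= gt_max lt_min.
  by move=> [/andP[-> ->] /andP[-> ->]].
by move=> /andP[/andP[-> ->] /andP[-> ->]].
Qed.

(** From open to measurable rectangles, one factor at a time, and from there to
    all measurable sets; each passage is a Dynkin class argument.  The full
    line is admitted as a factor because such an argument also needs the
    integral over the whole space to vanish. *)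
Lemma integral0_rectangles (W : plane -> \bar R) :
  mu.-integrable setT W ->
  (forall A B : set R, (A = setT \/ RGenOpens.G A) -> (B = setT \/ RGenOpens.G B) ->
     (\int[mu]_(z in A `*` B) W z = 0)%E) ->
  {ae mu, forall z, W z = 0%E}.
Proof.
move=> iW rW.
have W1 (A B : set (measurableTypeR R)) : measurable A -> (B = setT \/ RGenOpens.G B) ->
    (\int[mu]_(z in A `*` B) W z = 0)%E.
  move=> mA GB; have mB : measurable (B : set (measurableTypeR R)).
    by case: GB => [->//|[c [d ->]]]; exact: measurable_itv.
  have mSB : measurable ([set: measurableTypeR R] `*` B) by exact: measurableX.
  have E A' : (\int[mu]_(z in fst @^-1` A') (W \_ (setT `*` B)) z =
      \int[mu]_(z in A' `*` B) W z)%E.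
    rewrite -integral_mkcondr; congr (integral _ _ _).
    by apply/seteqP; split => z /= [? ]; [move=> [_ ?]|move=> ?].
  rewrite -E; apply: (@integral0_preimage _ _ _ _ _ mu _ _ (@RGenOpens.G R)) => //.
  - by apply/(integrable_mkcond _ mSB).1; exact: integrableS iW.
  - exact: RGenOpens.measurableE.
  - exact: setI_closed_itvoo.
  - have := E setT; rewrite preimage_setT => ->; apply: rW => //; by left.
  - by move=> A' GA'; rewrite E; apply: rW => //; right.
have W2 (A B : set (measurableTypeR R)) : measurable A -> measurable B ->
    (\int[mu]_(z in A `*` B) W z = 0)%E.
  move=> mA mB.
  have mSB : measurable (A `*` [set: measurableTypeR R]) by exact: measurableX.
  have E B' : (\int[mu]_(z in snd @^-1` B') (W \_ (A `*` setT)) z =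
      \int[mu]_(z in A `*` B') W z)%E.
    rewrite -integral_mkcondr; congr (integral _ _ _).
    by apply/seteqP; split => z /= [? ]; [move=> [? _]|move=> ?].
  rewrite -E; apply: (@integral0_preimage _ _ _ _ _ mu _ _ (@RGenOpens.G R)) => //.
  - by apply/(integrable_mkcond _ mSB).1; exact: integrableS iW.
  - exact: RGenOpens.measurableE.
  - exact: setI_closed_itvoo.
  - have := E setT; rewrite preimage_setT => ->; apply: W1 => //; by left.
  - by move=> B' GB'; rewrite E; apply: W1 => //; right.
have W3 (E : set plane) : measurable E -> (\int[mu]_(z in E) W z = 0)%E.
  apply: (@integral0_preimage _ _ _ _ _ mu _ id
    [set A `*` B | A in @measurable _ (measurableTypeR R) & B in @measurable _ (measurableTypeR R)]) => //.
  - exact: measurable_prod_measurableType.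
  - move=> _ _ [A mA [B mB <-]] [A' mA' [B' mB' <-]].
    by exists (A `&` A'); [exact: measurableI|exists (B `&` B'); [exact: measurableI|rewrite setXI]].
  - by rewrite -setXTT; apply: W2.
  - by move=> _ [A mA [B mB <-]]; rewrite preimage_id; exact: W2.
have : ae_eq mu setT W (cst 0%E).
  apply: integral_ae_eq => // E _ mE.
  by rewrite W3// integral0.
by apply: filterS => z /= /(_ I).
Qed.

End square.

Section bump.
Context {R : realType}.
Local Notation plane := (measurableTypeR R * measurableTypeR R)%type.
Local Notation mu := (@leb2 R).

(** The factor [n + 1] makes the bumps converge: [exp(-1/((n+1) q))] tends to 1
    wherever [q] is positive. *)
Definition bump_poly (a b : R) (n : nat) : {poly R} :=
  n.+1%:R *: (('X - a%:P) * (b%:P - 'X)).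

Definition bump (a b : R) (n : nat) : R -> R := flat (bump_poly a b n) 1 0.

Lemma bumpE a b n x : bump a b n x =
  if 0 < (x - a) * (b - x) then expR (- (n.+1%:R * ((x - a) * (b - x)))^-1) else 0.
Proof.
rewrite /bump /flat /bump_poly.
rewrite !(hornerZ, hornerM, hornerD, hornerN, hornerX, hornerC) expr0 !mul1r.
by rewrite pmulr_rgt0// ltr0n.
Qed.

Lemma bump_range a b n x : 0 <= bump a b n x <= 1.
Proof.
rewrite bumpE; case: ifPn => [h|]; last by rewrite lexx ler01.
by rewrite expR_ge0 -expR0 ler_expR oppr_le0 invr_ge0 mulr_ge0// ltW.
Qed.

Lemma bump_out a b n x : a <= b -> ~ `]a, b[%classic x -> bump a b n x = 0.
Proof.
rewrite /= in_itv /= => ab /negP; rewrite negb_and -!leNgt bumpE => xab.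
rewrite ifF//; apply/negbTE; rewrite -leNgt.
case/orP: xab => h; [apply: mulr_le0_ge0|apply: mulr_ge0_le0]; lra.
Qed.

Lemma bump_cvg a b x : `]a, b[%classic x -> bump a b n x @[n --> \oo] --> (1 : R).
Proof.
rewrite /= in_itv /= => /andP[ax xb].
have q0 : 0 < (x - a) * (b - x) by rewrite mulr_gt0// subr_gt0.
rewrite (_ : (fun n => _) =
    (fun n => expR (- (n.+1%:R^-1 * ((x - a) * (b - x))^-1)))); last first.
  by apply/funext => n; rewrite bumpE q0 invfM.
rewrite -[X in _ --> X](expR0 R); apply: continuous_cvg; first exact: continuous_expR.
rewrite -oppr0 -(mul0r ((x - a) * (b - x))^-1).
by apply: cvgN; apply: cvgMl; exact: cvg_harmonic.
Qed.

Definition bump2 (a b c d : R) n : R * R -> R := tensor (bump a b n) (bump c d n).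

Lemma bump2_test a b c d n : 0 < a -> a <= b -> b < 1 -> 0 < c -> c <= d -> d < 1 ->
  test_function (bump2 a b c d n).
Proof.
move=> a0 ab b1 c0 cd d1; split; first exact: smooth_tensor_flat.
exists (`[a, b]%classic `*` `[c, d]%classic); split.
- by apply: compact_setX; exact: segment_compact.
- move=> [x y] [/=]; rewrite !in_itv /= => /andP[h1 h2] /andP[h3 h4].
  by split; rewrite /= in_itv /=; lra.
- move=> [x y] /= /not_andP[] h; rewrite /bump2 /tensor /=.
    rewrite bump_out ?mul0r// => h'; apply: h; move: h'; rewrite /= !in_itv /=.
    by move=> /andP[/ltW -> /ltW ->].
  rewrite [X in _ * X]bump_out ?mulr0// => h'; apply: h; move: h'; rewrite /= !in_itv /=.
  by move=> /andP[/ltW -> /ltW ->].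
Qed.

Lemma bump2_continuous a b c d n : continuous (bump2 a b c d n).
Proof. by apply: tensor_continuous; exact: flat_continuous. Qed.

(** The bumps are bounded by 1 and converge to the indicator of the rectangle,
    so dominated convergence applies on the compact square where [w] is
    integrable. *)
Lemma integral0_rectangle (w : plane -> R) (e a b c d : R) :
  0 < e -> e <= a -> a <= b -> b <= 1 - e -> e <= c -> c <= d -> d <= 1 - e ->
  mu.-integrable (`[e, 1 - e]%classic `*` `[e, 1 - e]%classic) (EFin \o w) ->
  (forall phi, test_function phi -> \int[mu]_(z in Omega) (w z * phi z) = 0) ->
  (\int[mu]_(z in `]a, b[%classic `*` `]c, d[%classic) (w z)%:E = 0)%E.
Proof.
move=> e0 ea ab be ec cd de iw w0.
set K := _ `*` `[e, 1 - e]%classic in iw.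
have mK : measurable (K : set plane) by apply: measurableX; exact: measurable_itv.
have mI : measurable ((`]a, b[ `*` `]c, d[)%classic : set plane).
  by apply: measurableX; exact: measurable_itv.
have mw : measurable_fun (K : set plane) w by apply/measurable_EFinP; exact: measurable_int iw.
have phi01 n z : `|bump2 a b c d n z| <= 1.
  rewrite /bump2 /tensor normrM.
  have /andP[h1 h2] := bump_range a b n z.1; have /andP[h3 h4] := bump_range c d n z.2.
  by rewrite !ger0_norm// mulr_ile1.
have out n z : ~ (`]a, b[ `*` `]c, d[)%classic z -> bump2 a b c d n z = 0.
  move=> /= /not_andP[] h; rewrite /bump2 /tensor.
    by rewrite bump_out ?mul0r.
  by rewrite [X in _ * X]bump_out ?mulr0.
have IK : (`]a, b[ `*` `]c, d[)%classic `<=` K.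
  move=> [x y] [] /=; rewrite !in_itv /= => /andP[h1 h2] /andP[h3 h4].
  by split; rewrite /= in_itv /=; lra.
have IO : (`]a, b[ `*` `]c, d[)%classic `<=` Omega.
  move=> [x y] [] /=; rewrite !in_itv /= => /andP[h1 h2] /andP[h3 h4].
  by split; rewrite /= in_itv /=; lra.
have mphi n : measurable_fun (K : set plane) (fun z => w z * bump2 a b c d n z).
  apply: measurable_funM => //; apply: measurable_funTS.
  by apply: continuous_measurable2; exact: bump2_continuous.
have int0 n : (\int[mu]_(z in K) (w z * bump2 a b c d n z)%:E = 0)%E.
  have ii : mu.-integrable K (EFin \o (fun z => w z * bump2 a b c d n z)).
    apply: (@integrable_bound _ _ _ _ _ _ _ (fun z => `|w z|)) => //.
      exact: integrable_norm.
    by move=> z _; rewrite normrM ler_piMr.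
  rewrite -[LHS]fineK; last exact: (integrable_fin_num mK ii).
  have h := w0 _ (@bump2_test a b c d n ltac:(lra) ab ltac:(lra) ltac:(lra) cd ltac:(lra)).
  congr EFin; rewrite -[RHS]h -/(Rintegral _ _ _) Rintegral_mkcond [RHS]Rintegral_mkcond.
  apply: eq_Rintegral => z _; rewrite !patchE.
  have [Iz|nIz] := pselect ((`]a, b[ `*` `]c, d[)%classic z).
    by rewrite !mem_set//; [exact: IO|exact: IK].
  by rewrite out// mulr0; do 2 case: ifPn.
have mlim : measurable_fun (K : set plane) ((fun z => (w z)%:E) \_ (`]a, b[ `*` `]c, d[)%classic).
  apply: (measurable_restrict _ mI mK).1; rewrite setIidr//.
  by apply/measurable_EFinP; apply: measurable_funS mw.
have cvglim : {ae mu, forall z, K z -> (w z * bump2 a b c d n z)%:E @[n --> \oo] -->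
    ((fun z => (w z)%:E) \_ (`]a, b[ `*` `]c, d[)%classic) z}.
  apply: aeW => z _; rewrite patchE.
  have [Iz|nIz] := pselect ((`]a, b[ `*` `]c, d[)%classic z).
    rewrite mem_set//; apply/cvg_EFin; first exact: nearW.
    suff : w z * bump2 a b c d n z @[n --> \oo] --> w z * (1 * 1) by rewrite !mulr1.
    apply: cvgM; first exact: cvg_cst.
    by case: Iz => h1 h2; apply: cvgM; exact: bump_cvg.
  rewrite memNset// (_ : (fun n => _) = cst 0%E); first exact: cvg_cst.
  by apply/funext => n; rewrite out ?mulr0.
have iabs : mu.-integrable K (fun z => `|w z|%:E).
  exact: (integrable_norm iw).
have bd : {ae mu, forall z n, K z -> (`|(w z * bump2 a b c d n z)%:E| <= `|w z|%:E)%E}.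
  by apply: aeW => z n _ /=; rewrite lee_fin normrM ler_piMr.
have [_ _] := dominated_convergence mK
  (fun n => (measurable_EFinP _ _).2 (mphi n)) mlim cvglim iabs bd.
rewrite (_ : [sequence _]_n = cst 0%E); last first.
  by apply/funext => n /=; exact: int0.
rewrite -integral_mkcondr setIidr//.
move=> h; apply/esym/(cvg_unique _ _ h) => //; first exact: cvg_cst.
Qed.

End bump.

Section fundamental_lemma.
Context {R : realType}.
Local Notation plane := (measurableTypeR R * measurableTypeR R)%type.
Local Notation mu := (@leb2 R).

(** Lets the filter lemmas apply to statements that hold almost everywhere for
    [leb2]. *)
#[global] Instance leb2_ae_filter : Filter (nbhs (almost_everywhere mu)).
Proof. exact: ae_filter_ringOfSetsType. Qed.

Lemma itv_trace (e : R) (A : set R) : e <= 1 - e -> A = setT \/ RGenOpens.G A ->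
  A `&` `]e, 1 - e[%classic = set0 \/
  exists a b, [/\ e <= a, a <= b, b <= 1 - e & A `&` `]e, 1 - e[%classic = `]a, b[%classic].
Proof.
move=> e1 [->|[x [y ->]]]; first by right; exists e, (1 - e); rewrite setTI.
have E : `]x, y[%classic `&` `]e, 1 - e[%classic = `]Num.max x e, Num.min y (1 - e)[%classic.
  apply/seteqP; split => t /=; rewrite !in_itv /= gt_max lt_min.
    by move=> [/andP[-> ->] /andP[-> ->]].
  by move=> /andP[/andP[-> ->] /andP[-> ->]].
rewrite E; have [ab|ba] := lerP (Num.max x e) (Num.min y (1 - e)).
  right; exists (Num.max x e), (Num.min y (1 - e)).
  by rewrite ab le_max lexx orbT ge_min lexx orbT.
left; apply/seteqP; split => // t /=; rewrite in_itv /= => /andP[h1 h2].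
by have := lt_trans ba (lt_trans h1 h2); rewrite ltxx.
Qed.

(** Cut off to the open square, [w] becomes integrable on the whole plane, and
    the trace of an open rectangle on the square is an open rectangle or
    empty. *)
Lemma ae0_square (w : R * R -> R) (e : R) : 0 < e -> e <= 1 - e ->
  mu.-integrable (`[e, 1 - e]%classic `*` `[e, 1 - e]%classic) (EFin \o w) ->
  (forall phi, test_function phi -> \int[mu]_(z in Omega) (w z * phi z) = 0) ->
  {ae mu, forall z, (`]e, 1 - e[ `*` `]e, 1 - e[)%classic z -> w z = 0}.
Proof.
move=> e0 e1 iw w0; set U : set R := `]e, 1 - e[%classic.
have mU : measurable (U `*` U : set plane) by apply: measurableX; exact: measurable_itv.
have UK : U `*` U `<=` `[e, 1 - e]%classic `*` `[e, 1 - e]%classic.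
  by move=> [x y] [] /=; rewrite /U /= !in_itv /= => /andP[/ltW -> /ltW ->] /andP[/ltW -> /ltW ->].
have iW : mu.-integrable setT ((EFin \o w) \_ (U `*` U)).
  apply/(integrable_mkcond _ mU).1; apply: integrableS iw => //.
  by apply: measurableX; exact: measurable_itv.
suff : {ae mu, forall z : R * R, ((EFin \o w) \_ (U `*` U)) z = 0%E}.
  move=> H; apply: filterS H => z + Uz; by rewrite patchE mem_set// => -[].
apply: integral0_rectangles iW _ => A B GA GB.
rewrite -integral_mkcondr -setXI.
have [->|[a [b [ea ab be ->]]]] := itv_trace e1 GA.
  by rewrite set0X integral_set0.
have [->|[c [d [ec cd de ->]]]] := itv_trace e1 GB.
  by rewrite setX0 integral_set0.
exact: (@integral0_rectangle _ w e).
Qed.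

(** The fundamental lemma of the calculus of variations.  As [w] is integrable
    on compact subsets only, [Omega] is exhausted by smaller squares. *)
Theorem test_function_separate (w : R * R -> R) : locally_integrable_Omega w ->
  (forall phi, test_function phi -> \int[mu]_(z in Omega) (w z * phi z) = 0) ->
  {ae mu, forall z, Omega z -> w z = 0}.
Proof.
move=> [_ lw] w0.
pose e (n : nat) : R := n.+2%:R^-1.
have e0 n : 0 < e n by rewrite invr_gt0.
have e2 n : e n <= 2^-1 by rewrite lef_pV2 ?posrE// ler_nat.
have : {ae mu, forall z n, (`]e n, 1 - e n[ `*` `]e n, 1 - e n[)%classic z -> w z = 0}.
  apply: ae_foralln => n; have := e0 n; have := e2 n => e2n e0n.
  apply: ae0_square => //; first lra.
  apply: lw; first by apply: compact_setX; exact: segment_compact.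
  move=> [x y] [] /=; rewrite !in_itv /= => /andP[h1 h2] /andP[h3 h4].
  by split; rewrite /= in_itv /=; lra.
apply: filterS => -[x y] /= h [/=]; rewrite !in_itv /= => /andP[x0 x1] /andP[y0 y1].
pose m := Num.min (Num.min x (1 - x)) (Num.min y (1 - y)).
have m0 : 0 < m by rewrite !lt_min x0 y0 !subr_gt0 x1 y1.
have em : e (Num.truncn m^-1) < m.
  rewrite /e -[ltRHS]invrK ltf_pV2 ?posrE ?invr_gt0//.
  apply: lt_trans (truncnS_gt _) _; by rewrite ltr_nat.
move: em; rewrite {2}/m !lt_min => /andP[/andP[h1 h2] /andP[h3 h4]].
by apply: (h (Num.truncn m^-1)); split; rewrite /= in_itv /=; apply/andP; split; lra.
Qed.

End fundamental_lemma.

(** * Integrals of derivatives *)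

Section one_variable.
Context {R : realType}.
Local Notation leb := (@lebesgue_measure R).
Implicit Types (g : R -> R) (a b x : R).

Lemma FTC_segment g (g' : R -> R) a b : a < b -> (forall x, x \in `[a, b] -> is_derive x 1 g (g' x)) ->
  {within `[a, b], continuous g'} ->
  (\int[leb]_(x in `[a, b]) (g' x)%:E = (g b - g a)%:E)%E.
Proof.
move=> ab dg cg'; rewrite (@continuous_FTC2 _ _ g)//.
- have cg x : x \in `[a, b] -> {for x, continuous g}.
    move=> xab; have [d _] := dg _ xab.
    exact/differentiable_continuous/derivable1_diffP.
  split.
  + by move=> x xab; have [] := dg x (subset_itv_oo_cc xab).
  + by apply: cvg_at_right_filter; apply: cg; rewrite bound_itvE ltW.
  + by apply: cvg_at_left_filter; apply: cg; rewrite bound_itvE ltW.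
- by move=> x xab; rewrite derive1E; have [_ ->] := dg x (subset_itv_oo_cc xab).
Qed.

Section compactly_supported.
Variables g g' : R -> R.
Hypotheses (dg : forall x : R, is_derive x 1 g (g' x)) (cg' : continuous g').
Hypotheses (g0 : forall x, ~ `]0, 1[%classic x -> g x = 0).
Hypotheses (g'0 : forall x, ~ `]0, 1[%classic x -> g' x = 0).

Let cg'W a b : {within `[a, b], continuous g'}.
Proof. exact: continuous_subspaceT. Qed.

Lemma integral_derive0 : (\int[leb]_x (g' x)%:E = 0)%E.
Proof.
transitivity (\int[leb]_(x in `[0%R, 1%R]) (g' x)%:E)%E.
  rewrite [RHS]integral_mkcond; apply: eq_integral => x _; rewrite patchE.
  case: ifPn => // /negP; rewrite inE => h; rewrite g'0// => h'; apply: h.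
  by move: h'; rewrite /= !in_itv /= => /andP[/ltW -> /ltW ->].
rewrite (@FTC_segment g)//.
by rewrite !g0 ?subrr//= in_itv /= ltxx ?andbF.
Qed.

(** [g] vanishes at 0, so it is the integral of its derivative from 0. *)
Lemma le_integral_derive (x : R) : (`|g x|%:E <= \int[leb]_y `|g' y|%:E)%E.
Proof.
have mg' : measurable_fun setT (fun y => `|g' y|%:E).
  apply/measurable_EFinP; apply: measurableT_comp => //.
  exact: continuous_measurable_fun.
have [/andP[x0 x1]|nx] := boolP (0 < x < 1); last first.
  rewrite g0; last exact/negP.
  by rewrite normr0 integral_ge0.
have g00 : g 0 = 0 by apply: g0; rewrite /= in_itv /= ltxx.
have -> : g x = g x - g 0 by rewrite g00 subr0.
rewrite -abse_EFin -(@FTC_segment g g')//.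
apply: le_trans (le_abse_integral _ _ _) _ => //.
  apply/measurable_EFinP/measurable_funTS; exact: continuous_measurable_fun.
by apply: ge0_subset_integral => //; exact: measurable_itv.
Qed.

End compactly_supported.

(** The primitive [x^(1-s) / (1-s)] bounds the integrals over [[1/(n+2), 1]]
    uniformly in [n]. *)
Lemma integral_powRN_lty (s : R) : 0 < s < 1 ->
  (\int[leb]_(x in `]0%R, 1%R[) (x `^ (- s))%:E < +oo)%E.
Proof.
move=> /andP[s0 s1].
have mp : measurable_fun setT (fun x : R => (x `^ (- s))%:E).
  by apply/measurable_EFinP; exact: measurable_powR.
have p0 x : (0 <= (x `^ (- s))%:E)%E by rewrite lee_fin powR_ge0.
pose F n : set R := `[n.+2%:R^-1, 1]%classic.
have n0 n : 0 < n.+2%:R^-1 :> R by rewrite invr_gt0.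
have mF n : measurable (F n) by exact: measurable_itv.
have ndF : nondecreasing_seq F.
  move=> m n mn; rewrite subsetEset => x; rewrite /F /= !in_itv /= => /andP[h ->].
  by rewrite andbT (le_trans _ h)// lef_pV2 ?posrE// ler_nat !ltnS.
have FB n : (\int[leb]_(x in F n) (x `^ (- s))%:E <= ((1 - s)^-1)%:E)%E.
  have pos x : x \in `[n.+2%:R^-1, (1:R)] -> 0 < x.
    by rewrite in_itv /= => /andP[h _]; exact: lt_le_trans h.
  have d a x : 0 < x -> is_derive x 1 (fun y => y `^ a) (a * x `^ (a - 1)).
    exact: is_derive1_powR.
  have dF x : x \in `[n.+2%:R^-1, (1 : R)] ->
      is_derive x 1 (fun x => (1 - s)^-1 *: x `^ (1 - s)) (x `^ (- s)).
    move=> /pos x0; have dx := d (1 - s) x x0.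
    apply: (is_derive_eq (is_deriveZ _ dx)).
    rewrite /GRing.scale /= mulrA mulVf ?mul1r; last by apply/eqP; lra.
    by congr powR; lra.
  have cF : {within `[n.+2%:R^-1, (1 : R)], continuous (fun x => x `^ (- s))}.
    apply: derivable_within_continuous => x /pos x0.
    by have [] := d (- s) x x0.
  rewrite (FTC_segment _ dF cF); last by rewrite invf_lt1// ltr1n.
  rewrite lee_fin /GRing.scale /= powR1 mulr1 lerBlDr lerDl mulr_ge0 ?powR_ge0//.
  by rewrite invr_ge0; lra.
apply: (@le_lt_trans _ _ ((1 - s)^-1)%:E); last exact: ltry.
apply: (@le_trans _ _ (\int[leb]_(x in \bigcup_n F n) (x `^ (- s))%:E)%E).
  apply: ge0_subset_integral => //.
  - by apply: bigcupT_measurable.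
  - exact: measurable_funTS.
  - move=> x; rewrite /= in_itv /= => /andP[x0 x1].
    exists (Num.truncn x^-1) => //; rewrite /F /= in_itv /= (ltW x1) andbT.
    rewrite -[leRHS]invrK lef_pV2 ?posrE ?invr_gt0// ltW//.
    by apply: lt_trans (truncnS_gt _) _; rewrite ltr_nat.
have := @ge0_nondecreasing_set_cvg_integral _ (measurableTypeR R) R F (fun x => (x `^ (- s))%:E) leb ndF mF
  (fun i => measurable_funTS mp) (fun i x _ => p0 x).
move=> /cvg_lim <- //; apply: lime_le; last exact: nearW.
apply: ereal_nondecreasing_is_cvgn.
apply: ge0_nondecreasing_set_nondecreasing_integral => //.
by move=> i; exact: measurable_funTS.
Qed.

End one_variable.

Section plane_calculus.
Context {R : realType}.
Implicit Types (F phi psi : R * R -> R) (e : R * R).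
Local Notation plane := (measurableTypeR R * measurableTypeR R)%type.
Local Notation mu := (@leb2 R).
Local Notation leb := (@lebesgue_measure R).
Local Notation L2O := (L2 mu Omega).
Local Notation dotO := (dot mu Omega).

(** What integration by parts requires.  Products stay in this class by the
    Leibniz rule for a single derivative, whereas for test functions every
    iterated derivative of the product would have to be expanded. *)
Definition C1_supported e F := [/\ continuous F, forall z, derivable F z e,
  continuous ('D_e F : R * R -> R) &
  exists K : set (R * R), [/\ compact K, K `<=` Omega & forall z, ~ K z -> F z = 0]].

Lemma derive_support (K : set (R * R)) e F : closed K -> (forall z, ~ K z -> F z = 0) ->
  forall z, ~ K z -> 'D_e F z = 0.
Proof.
move=> cK FK z nKz.
rewrite -(derive_cst (0 : R) z e); apply: near_eq_derive.
have : open_nbhs z (~` K) by split => //; exact: closed_openC.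
by move=> /open_nbhs_nbhs; apply: filterS => t /FK.
Qed.

Lemma support_bounded (K : set (R * R)) F : compact K -> continuous F ->
  (forall z, ~ K z -> F z = 0) -> exists M, forall z, `|F z| <= M.
Proof.
move=> cK cF FK; have [[z0 Kz0]|K0] := pselect (K !=set0); last first.
  exists 0 => z; rewrite FK ?normr0// => Kz; apply: K0; by exists z.
have cn : {within K, continuous (fun z => `|F z|)}.
  apply: continuous_subspaceT => z.
  by apply: (@continuous_comp _ _ _ F Num.norm); [exact: cF|exact: norm_continuous].
have [c _ cP] := compact_EVT_max (ex_intro _ z0 Kz0) cK cn.
exists `|F c| => z; have [Kz|nKz] := pselect (K z); first by apply: cP; rewrite inE.
by rewrite FK ?normr0.
Qed.

Lemma C1_derive_support e F : C1_supported e F ->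
  exists K : set (R * R), [/\ compact K, K `<=` Omega, forall z, ~ K z -> F z = 0
    & forall z, ~ K z -> 'D_e F z = 0].
Proof.
move=> [_ _ _ [K [cK KO FK]]]; exists K; split => //.
by apply: derive_support => //; apply: compact_closed => //; exact: norm_hausdorff.
Qed.

Lemma continuous_supported_L2 (K : set (R * R)) F : compact K -> continuous F ->
  (forall z, ~ K z -> F z = 0) -> L2O F.
Proof.
move=> cK cF FK; have [M FM] := support_bounded cK cF FK.
apply: (@L2_bounded _ _ _ _ _ measurable_Omega _ M) => //; first exact: leb2_Omega_lty.
by apply: measurable_funTS; exact: continuous_measurable2.
Qed.

Lemma C1_L2 e F : C1_supported e F -> L2O F.
Proof. by move=> [cF _ _ [K [cK _ FK]]]; exact: (continuous_supported_L2 cK). Qed.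

Lemma C1_derive_L2 e F : C1_supported e F -> L2O ('D_e F).
Proof.
move=> HF; have [K [cK KO _ DK]] := C1_derive_support HF.
by case: HF => _ _ cD _; exact: (continuous_supported_L2 cK).
Qed.

Lemma slice_ex_continuous (G : R * R -> R) (y : R) : continuous G -> continuous (fun t => G (t, y)).
Proof.
move=> cG t; apply: (@continuous_comp _ _ _ (fun t => (t, y)) G); last exact: cG.
by apply: (@cvg_pair _ _ _ _ (nbhs (t : R)) (nbhs (y : R))); [exact: cvg_id|exact: cvg_cst].
Qed.

Lemma slice_ey_continuous (G : R * R -> R) (x : R) : continuous G -> continuous (fun t => G (x, t)).
Proof.
move=> cG t; apply: (@continuous_comp _ _ _ (fun t => (x, t)) G); last exact: cG.
by apply: (@cvg_pair _ _ _ _ (nbhs (x : R)) (nbhs (t : R))); [exact: cvg_cst|exact: cvg_id].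
Qed.

Lemma integral_Omega_supported (f : R * R -> \bar R) : (forall z, ~ Omega z -> f z = 0%E) ->
  (\int[mu]_(z in Omega) f z = \int[mu]_z f z)%E.
Proof.
move=> f0; rewrite integral_mkcond; apply: eq_integral => z _; rewrite patchE.
by case: ifPn => // /negP; rewrite inE => /f0.
Qed.

Lemma integrable_Omega_supported (f : R * R -> R) :
  measurable_fun (setT : set plane) f -> L2O f -> (forall z, ~ Omega z -> f z = 0) ->
  mu.-integrable setT (EFin \o f).
Proof.
move=> mf Lf f0; have := L2_integrable measurable_Omega leb2_Omega_lty Lf.
move/(integrable_mkcond _ measurable_Omega); apply: eq_integrable => // z _.
rewrite patchE; case: ifPn => // /negP; rewrite inE /= => /f0 -> //.
Qed.

(** By Fubini's theorem it suffices to integrate along horizontal lines, on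
    which [F] vanishes at both ends. *)
Lemma integral_derive_ex F : C1_supported ex F -> \int[mu]_(z in Omega) ('D_ex F z) = 0.
Proof.
move=> HF; have LD := C1_derive_L2 HF; have [K [cK KO FK DK]] := C1_derive_support HF.
have [cF dF cD _] := HF.
have DO z : ~ Omega z -> 'D_ex F z = 0 by move=> nO; apply: DK => /KO.
have FO z : ~ Omega z -> F z = 0 by move=> nO; apply: FK => /KO.
have mD : measurable_fun (setT : set plane) ('D_ex F) by exact: continuous_measurable2 cD.
rewrite /Rintegral integral_Omega_supported; last by move=> z /DO ->.
have iD := integrable_Omega_supported mD LD DO.
have := @integral21_prod_meas1 _ _ _ _ R leb leb _ iD; rewrite -/leb2 => <-.
rewrite integral0_eq// => y _; rewrite /fubini_G.
apply: (@integral_derive0 _ (fun t => F (t, y))).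
- move=> x; apply/(is_derive_ex F (x, y)); split => //; exact: dF.
- by apply: (slice_ex_continuous (G := 'D_ex F)).
- by move=> x nx; apply: FO => -[].
- by move=> x nx; apply: DO => -[].
Qed.

Lemma integral_derive_ey F : C1_supported ey F -> \int[mu]_(z in Omega) ('D_ey F z) = 0.
Proof.
move=> HF; have LD := C1_derive_L2 HF; have [K [cK KO FK DK]] := C1_derive_support HF.
have [cF dF cD _] := HF.
have DO z : ~ Omega z -> 'D_ey F z = 0 by move=> nO; apply: DK => /KO.
have FO z : ~ Omega z -> F z = 0 by move=> nO; apply: FK => /KO.
have mD : measurable_fun (setT : set plane) ('D_ey F) by exact: continuous_measurable2 cD.
rewrite /Rintegral integral_Omega_supported; last by move=> z /DO ->.
have iD := integrable_Omega_supported mD LD DO.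
have := @integral12_prod_meas1 _ _ _ _ R leb leb _ iD; rewrite -/leb2 => <-.
rewrite integral0_eq// => x _; rewrite /fubini_F.
apply: (@integral_derive0 _ (fun t => F (x, t))).
- move=> y; apply/(is_derive_ey F (x, y)); split => //; exact: dF.
- by apply: (slice_ey_continuous (G := 'D_ey F)).
- by move=> y ny; apply: FO => -[].
- by move=> y ny; apply: DO => -[].
Qed.

(** On the line through [z] in either direction, [|phi z|] is at most the
    integral of the absolute value of the derivative.  The horizontal bound
    depends only on [z.2] and the vertical one only on [z.1], so the integral
    of their product is the product of their integrals. *)
Lemma gagliardo_nirenberg phi : C1_supported ex phi -> C1_supported ey phi ->
  dotO phi phi <= (\int[mu]_(z in Omega) `|'D_ex phi z|) * (\int[mu]_(z in Omega) `|'D_ey phi z|).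
Proof.
move=> Hx Hy.
have LF := C1_L2 Hx; have Lx := C1_derive_L2 Hx; have Ly := C1_derive_L2 Hy.
have [Kx [_ KxO FKx DKx]] := C1_derive_support Hx.
have [Ky [_ KyO FKy DKy]] := C1_derive_support Hy.
have FO z : ~ Omega z -> phi z = 0 by move=> nO; apply: FKx => /KxO.
have DxO z : ~ Omega z -> 'D_ex phi z = 0 by move=> nO; apply: DKx => /KxO.
have DyO z : ~ Omega z -> 'D_ey phi z = 0 by move=> nO; apply: DKy => /KyO.
have [cF dx cDx _] := Hx; have [_ dy cDy _] := Hy.
pose fx (z : plane) : \bar R := `|'D_ex phi z|%:E.
pose fy (z : plane) : \bar R := `|'D_ey phi z|%:E.
have mDx : measurable_fun (setT : set plane) ('D_ex phi) by exact: continuous_measurable2 cDx.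
have mfx : measurable_fun setT fx.
  by apply/measurable_EFinP; exact: (measurableT_comp (@normr_measurable _ setT) mDx).
have mDy : measurable_fun (setT : set plane) ('D_ey phi) by exact: continuous_measurable2 cDy.
have mfy : measurable_fun setT fy.
  by apply/measurable_EFinP; exact: (measurableT_comp (@normr_measurable _ setT) mDy).
have fx0 z : (0 <= fx z)%E by rewrite lee_fin.
have fy0 z : (0 <= fy z)%E by rewrite lee_fin.
have Ax z : (`|phi z|%:E <= fubini_G leb fx z.2)%E.
  case: z => x0 y /=.
  apply: (@le_integral_derive _ (fun t => phi (t, y)) (fun t => 'D_ex phi (t, y)) _ _ _ x0).
  - move=> x; apply/(is_derive_ex phi (x, y)); split => //; exact: dx.
  - by apply: (slice_ex_continuous (G := 'D_ex phi)).
  - by move=> x nx; apply: FO => -[].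
have By z : (`|phi z|%:E <= fubini_F leb fy z.1)%E.
  case: z => x y0 /=.
  apply: (@le_integral_derive _ (fun t => phi (x, t)) (fun t => 'D_ey phi (x, t)) _ _ _ y0).
  - move=> y; apply/(is_derive_ey phi (x, y)); split => //; exact: dy.
  - by apply: (slice_ey_continuous (G := 'D_ey phi)).
  - by move=> y ny; apply: FO => -[].
have mA : measurable_fun setT (fubini_G leb fx) by exact: (measurable_fun_fubini_tonelli_G fx mfx fx0).
have mB : measurable_fun setT (fubini_F leb fy) by exact: (measurable_fun_fubini_tonelli_F fy mfy fy0).
have A0 y : (0 <= fubini_G leb fx y)%E by exact: integral_ge0.
have B0 x : (0 <= fubini_F leb fy x)%E by exact: integral_ge0.
have iE (f : R * R -> R) : L2O f -> continuous f -> (forall z, ~ Omega z -> f z = 0) ->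
    (\int[mu]_z `|f z|%:E = (\int[mu]_(z in Omega) `|f z|)%:E)%E.
  move=> Lf cf f0; rewrite -integral_Omega_supported; last by move=> z /f0 ->; rewrite normr0.
  rewrite /Rintegral fineK//.
  have := L2_integrable measurable_Omega leb2_Omega_lty Lf.
  by move/integrable_norm/(integrable_fin_num measurable_Omega).
have ExE := iE _ Lx cDx DxO; have EyE := iE _ Ly cDy DyO.
suff H : ((dotO phi phi)%:E <= (\int[mu]_z `|'D_ex phi z|%:E) * (\int[mu]_z `|'D_ey phi z|%:E))%E.
  by move: H; rewrite ExE EyE -EFinM lee_fin.
clear ExE EyE iE.
rewrite (dotE measurable_Omega LF).
rewrite integral_Omega_supported; last by move=> z /FO ->; rewrite expr0n.
have -> : (\int[mu]_z `|'D_ex phi z|%:E = \int[leb]_y fubini_G leb fx y)%E.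
  exact: (@fubini_tonelli2 _ _ _ _ R leb leb fx mfx fx0).
have -> : (\int[mu]_z `|'D_ey phi z|%:E = \int[leb]_x fubini_F leb fy x)%E.
  exact: (@fubini_tonelli1 _ _ _ _ R leb leb fy mfy fy0).
have mAB : measurable_fun (setT : set plane) (fun z => fubini_G leb fx z.2 * fubini_F leb fy z.1)%E.
  apply: emeasurable_funM.
    exact: (measurableT_comp mA measurable_snd).
  exact: (measurableT_comp mB measurable_fst).
have AB0 z : (0 <= fubini_G leb fx z.2 * fubini_F leb fy z.1)%E by exact: mule_ge0.
apply: (@le_trans _ _ (\int[mu]_z (fubini_G leb fx z.2 * fubini_F leb fy z.1))%E).
  apply: ge0_le_integral => //.
  - by move=> z _; rewrite lee_fin sqr_ge0.
  - apply/measurable_EFinP; apply: measurable_funX; exact: continuous_measurable2.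
  - move=> z _; rewrite -(real_normK (num_real (phi z))) expr2 EFinM.
    have p0 : (0 <= `|phi z|%:E)%E by rewrite lee_fin.
    exact: (lee_pmul p0 p0 (Ax z) (By z)).
have -> := @fubini_tonelli2 _ _ _ _ R leb leb _ mAB AB0.
rewrite (eq_integral (fun y => fubini_G leb fx y * \int[leb]_x fubini_F leb fy x)%E); last first.
  move=> y _; rewrite [LHS]/fubini_G /=.
  by apply: (@ge0_integralZl _ _ _ leb _ measurableT _ _ _ (fun x _ => B0 x) (A0 y)).
have B00 : (0 <= \int[leb]_x fubini_F leb fy x)%E by apply: integral_ge0 => x _; exact: B0.
by rewrite (@ge0_integralZr _ _ _ leb _ measurableT _ mA _ (fun y _ => A0 y) B00).
Qed.

End plane_calculus.

(** * Test functions and weak derivatives *)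

Section test_functions.
Context {R : realType}.
Implicit Types (F u v w phi psi : R * R -> R) (e : R * R).
Local Notation plane := (measurableTypeR R * measurableTypeR R)%type.
Local Notation mu := (@leb2 R).
Local Notation L2O := (L2 mu Omega).
Local Notation dotO := (dot mu Omega).

Definition axis e : Prop := e = ex \/ e = ey.

Lemma integral_derive e F : axis e -> C1_supported e F ->
  \int[mu]_(z in Omega) ('D_e F z) = 0.
Proof. by case=> ->; [exact: integral_derive_ex|exact: integral_derive_ey]. Qed.

Lemma test_C1 e phi : axis e -> test_function phi -> C1_supported e phi.
Proof.
move=> axe [sphi Kphi].
have [cphi dphi] : continuous phi /\ forall z, derivable phi z ex /\ derivable phi z ey.
  exact: (sphi [::]).
have [cD _] : continuous (partials [:: e] phi) /\
    forall z, derivable (partials [:: e] phi) z ex /\ derivable (partials [:: e] phi) z ey.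
  by apply: sphi => x; rewrite !inE => /eqP ->; case: axe => ->; rewrite eqxx ?orbT.
split => //.
by move=> z; case: axe => ->; have [] := dphi z.
Qed.

Lemma derivable_comb phi t psi z e : derivable phi z e -> derivable psi z e ->
  derivable (comb phi t psi) z e.
Proof.
move=> d1 d2; rewrite (_ : comb phi t psi = phi + t *: psi); last exact/funext.
by apply: derivableD; [exact: d1|apply: derivableZ; exact: d2].
Qed.

Lemma derive_comb phi t psi z e : derivable phi z e -> derivable psi z e ->
  'D_e (comb phi t psi) z = comb ('D_e phi) t ('D_e psi) z.
Proof.
move=> d1 d2; rewrite (_ : comb phi t psi = phi + t *: psi); last exact/funext.
have d3 : derivable (t *: psi) z e by apply: derivableZ; exact: d2.
by rewrite (deriveD d1 d3) (deriveZ _ d2).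
Qed.

Lemma continuous_comb phi t psi : continuous phi -> continuous psi ->
  continuous (comb phi t psi).
Proof.
move=> c1 c2 z; apply: cvgD; first exact: c1.
by apply: cvgM; [exact: cvg_cst|exact: c2].
Qed.

Lemma partials_comb s phi t psi : smooth phi -> smooth psi -> {subset s <= [:: ex; ey]} ->
  partials s (comb phi t psi) = comb (partials s phi) t (partials s psi).
Proof.
move=> sp sq; elim: s => [//|e s IH] sub /=.
have sub' : {subset s <= [:: ex; ey]} by move=> x xs; apply: sub; rewrite inE xs orbT.
rewrite (IH sub'); apply/funext => z.
have [_ /(_ z) [p1 p2]] := sp s sub'; have [_ /(_ z) [q1 q2]] := sq s sub'.
have := sub e (mem_head _ _); rewrite !inE => /orP[] /eqP ->.
  exact: (derive_comb t p1 q1).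
exact: (derive_comb t p2 q2).
Qed.

Lemma test_comb phi t psi : test_function phi -> test_function psi ->
  test_function (comb phi t psi).
Proof.
move=> [sp [K [cK KO pK]]] [sq [L [cL LO qL]]]; split.
  move=> s sub; rewrite partials_comb//.
  have [c1 d1] := sp s sub; have [c2 d2] := sq s sub; split.
    exact: continuous_comb.
  move=> z; have [p1 p2] := d1 z; have [q1 q2] := d2 z.
  by split; exact: derivable_comb.
exists (K `|` L); split; first exact: compactU.
  by move=> z [/KO|/LO].
by move=> z /not_orP[nK nL]; rewrite /comb pK// qL// mulr0 addr0.
Qed.

Lemma C1_mul e phi psi : C1_supported e phi -> C1_supported e psi ->
  C1_supported e (phi * psi) /\
  'D_e (phi * psi) = (fun z => phi z * 'D_e psi z + 'D_e phi z * psi z).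
Proof.
move=> [c1 d1 D1 [K [cK KO pK]]] [c2 d2 D2 _].
have DE : 'D_e (phi * psi) = (fun z => phi z * 'D_e psi z + 'D_e phi z * psi z).
  apply/funext => z; have := deriveM (d1 z) (d2 z) => ->.
  by rewrite /GRing.scale /= [X in _ + X]mulrC.
split; last exact: DE.
split.
- by move=> z; apply: cvgM; [exact: c1|exact: c2].
- by move=> z; apply: derivableM; [exact: d1|exact: d2].
- rewrite DE => z; apply: cvgD; apply: cvgM;
    [exact: c1|exact: D2|exact: D1|exact: c2].
- by exists K; split => // z nKz; rewrite fctE pK// mul0r.
Qed.

Lemma integrable_locally_integrable w : mu.-integrable Omega (EFin \o w) ->
  locally_integrable_Omega w.
Proof.
move=> iw; split; first by apply/measurable_EFinP; exact: measurable_int iw.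
move=> K cK KO; apply: integrableS iw => //; first exact: measurable_Omega.
exact: compact_measurable2.
Qed.

Lemma L2_locally_integrable u : L2O u -> locally_integrable_Omega u.
Proof.
move=> Lu; apply: integrable_locally_integrable.
exact: (L2_integrable measurable_Omega leb2_Omega_lty Lu).
Qed.

Lemma integration_by_parts_plane e phi psi : axis e -> C1_supported e phi -> C1_supported e psi ->
  \int[mu]_(z in Omega) (phi z * 'D_e psi z) = - \int[mu]_(z in Omega) ('D_e phi z * psi z).
Proof.
move=> axe Hphi Hpsi; have [Hm DE] := C1_mul Hphi Hpsi.
have := integral_derive axe Hm; rewrite DE RintegralD.
- by move/eqP; rewrite addr_eq0 => /eqP.
- exact: measurable_Omega.
- exact: (L2_integrableM measurable_Omega (C1_L2 Hphi) (C1_derive_L2 Hpsi)).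
- exact: (L2_integrableM measurable_Omega (C1_derive_L2 Hphi) (C1_L2 Hpsi)).
Qed.

Lemma test_weak_partial e phi : axis e -> test_function phi ->
  is_weak_partial e phi ('D_e phi).
Proof.
move=> axe tphi; have Hphi := test_C1 axe tphi; split.
- exact: (L2_locally_integrable (C1_L2 Hphi)).
- exact: (L2_locally_integrable (C1_derive_L2 Hphi)).
- by move=> psi tpsi; apply: integration_by_parts_plane => //; exact: test_C1.
Qed.

(** Continuity and compact support make [phi] bounded and confine the product
    to a compact set, where [w] is integrable. *)
Lemma integrable_mul_supported w phi (K : set (R * R)) : locally_integrable_Omega w ->
  compact K -> K `<=` Omega -> continuous phi -> (forall z, ~ K z -> phi z = 0) ->
  mu.-integrable Omega (EFin \o (fun z => w z * phi z)).
Proof.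
move=> [mw lw] cK KO cphi pK; have [M phiM] := support_bounded cK cphi pK.
have mK := compact_measurable2 cK; have mO := @measurable_Omega R.
have mphi : measurable_fun (Omega : set plane) phi.
  by apply: measurable_funTS; exact: continuous_measurable2 cphi.
have iK : mu.-integrable K (EFin \o (fun z => w z * phi z)).
  apply: (@integrable_bound _ _ R mu K mK _ (fun z => `|w z| * M)) => //.
  - apply: measurable_funM; first exact: (measurable_funS mO KO mw).
    exact: (measurable_funS mO KO mphi).
  - have := integrableZr mK M (integrable_norm (lw _ cK KO)).
    by apply: eq_integrable.
  - by move=> z _; rewrite normrM ler_wpM2l.
apply/(integrable_mkcond _ mO); move/(integrable_mkcond _ mK) : iK.
apply: eq_integrable => // z _; rewrite !patchE.
have [Kz|nKz] := pselect (K z).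
  by rewrite !mem_set//; exact: KO.
by rewrite (memNset nKz); case: ifPn => //= _; rewrite pK// mulr0.
Qed.

Lemma integrable_mul_test w phi : locally_integrable_Omega w -> test_function phi ->
  mu.-integrable Omega (EFin \o (fun z => w z * phi z)).
Proof.
move=> lw tphi; have [cphi _ _ [K [cK KO pK]]] := test_C1 (or_introl erefl) tphi.
exact: integrable_mul_supported lw cK KO cphi pK.
Qed.

Lemma integrable_mul_test_derive e w phi : axis e -> locally_integrable_Omega w ->
  test_function phi -> mu.-integrable Omega (EFin \o (fun z => w z * 'D_e phi z)).
Proof.
move=> axe lw tphi; have H := test_C1 axe tphi.
have [K [cK KO _ DK]] := C1_derive_support H; have [_ _ cD _] := H.
exact: integrable_mul_supported lw cK KO cD DK.
Qed.

Lemma locally_integrable_comb u t v : locally_integrable_Omega u -> locally_integrable_Omega v ->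
  locally_integrable_Omega (comb u t v).
Proof.
move=> [mu_ lu] [mv lv]; split.
  by apply: measurable_funD => //; exact: measurable_funM.
move=> K cK KO; have mK := compact_measurable2 cK.
exact: (integrableD mK (lu _ cK KO) (integrableZl mK t (lv _ cK KO))).
Qed.

Lemma Rintegral_comb u t v phi :
  mu.-integrable Omega (EFin \o (fun z => u z * phi z)) ->
  mu.-integrable Omega (EFin \o (fun z => v z * phi z)) ->
  \int[mu]_(z in Omega) (comb u t v z * phi z) =
  \int[mu]_(z in Omega) (u z * phi z) + t * \int[mu]_(z in Omega) (v z * phi z).
Proof.
move=> iu iv; rewrite -RintegralZl//; last exact: measurable_Omega.
rewrite -RintegralD//; last 2 first.
- exact: measurable_Omega.
- exact: (integrableZl measurable_Omega t iv).
by apply: eq_Rintegral => z _; rewrite /comb; ring.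
Qed.

Lemma is_weak_partial_comb e u t v wu wv : axis e ->
  is_weak_partial e u wu -> is_weak_partial e v wv ->
  is_weak_partial e (comb u t v) (comb wu t wv).
Proof.
move=> axe [lu lwu hu] [lv lwv hv]; split; try exact: locally_integrable_comb.
move=> phi tphi; rewrite !Rintegral_comb ?hu ?hv//; first by ring.
- exact: integrable_mul_test.
- exact: integrable_mul_test.
- exact: integrable_mul_test_derive.
- exact: integrable_mul_test_derive.
Qed.

Lemma is_weak_partial_unique e u w1 w2 :
  is_weak_partial e u w1 -> is_weak_partial e u w2 ->
  {ae mu, forall z, Omega z -> w1 z = w2 z}.
Proof.
move=> [_ l1 h1] [_ l2 h2].
have : {ae mu, forall z, Omega z -> comb w1 (-1) w2 z = 0}.
  apply: test_function_separate; first exact: locally_integrable_comb.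
  move=> phi tphi; rewrite Rintegral_comb; [|exact: integrable_mul_test..].
  by have := h1 _ tphi; rewrite h2// => /oppr_inj ->; ring.
apply: filterS => z h /h; rewrite /comb mulN1r => /eqP.
by rewrite subr_eq0 => /eqP.
Qed.

Lemma weak_partialP e u : has_weak_partial e u -> is_weak_partial e u (weak_partial e u).
Proof. by move=> h; exact: (xgetPex _ h). Qed.

End test_functions.

(** * Weighted weak derivatives *)

Section weighted_weak_derivative.
Context {R : realType}.
Local Notation plane := (measurableTypeR R * measurableTypeR R)%type.
Local Notation mu := (@leb2 R).
Local Notation L2O := (L2 mu Omega).
Local Notation dotO := (dot mu Omega).
Variables (e : R * R) (rho : R * R -> R).
Hypotheses (axe : axis e) (mrho : measurable_fun (Omega : set plane) rho)
  (rho0 : forall z, Omega z -> 0 < rho z) (rho1 : forall z, Omega z -> rho z <= 1)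
  (Lrho : L2O (fun z => (rho z)^-1)).
Implicit Types (u v w g phi : R * R -> R).

Definition wder u : R * R -> R := fun z => rho z * weak_partial e u z.

Definition W12 : set (R * R -> R) :=
  [set u | [/\ L2O u, has_weak_partial e u & L2O (wder u)]].

Let mO := @measurable_Omega R.

Lemma rho_norm1 z : Omega z -> `|rho z| <= 1.
Proof. by move=> Oz; rewrite ger0_norm ?rho1// ltW// rho0. Qed.

Lemma wder_ae u w : is_weak_partial e u w ->
  {ae mu, forall z, Omega z -> wder u z = rho z * w z}.
Proof.
move=> hw; have hu : has_weak_partial e u by exists w.
apply: filterS (is_weak_partial_unique (weak_partialP hu) hw) => z h /h.
by rewrite /wder => ->.
Qed.

Lemma measurable_wder u : has_weak_partial e u -> measurable_fun (Omega : set plane) (wder u).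
Proof.
move=> hu; apply: measurable_funM => //.
by have [_ [mw _] _] := weak_partialP hu.
Qed.

Lemma W12_intro u w : L2O u -> is_weak_partial e u w -> L2O (fun z => rho z * w z) -> W12 u.
Proof.
move=> Lu hw Lw; have hu : has_weak_partial e u by exists w.
split => //; apply: L2_ae Lw => //; first exact: measurable_wder.
by apply: filterS (wder_ae hw) => z h /h.
Qed.

Lemma W12_comb u t v : W12 u -> W12 v -> W12 (comb u t v).
Proof.
move=> [Lu hu Wu] [Lv hv Wv].
have hw := is_weak_partial_comb t axe (weak_partialP hu) (weak_partialP hv).
apply: W12_intro hw _; first exact: (L2_comb mO).
have := L2_comb mO t Wu Wv; congr L2; apply/funext => z; rewrite /comb /wder; ring.
Qed.

Lemma wder_ae_linear : ae_linear mu Omega W12 wder.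
Proof.
split=> [u []//|u t v [Lu hu Wu] [Lv hv Wv]].
have hw := is_weak_partial_comb t axe (weak_partialP hu) (weak_partialP hv).
apply: filterS (wder_ae hw) => z h /h ->.
by rewrite /comb /wder; ring.
Qed.

Lemma test_W12 phi : test_function phi ->
  W12 phi /\ {ae mu, forall z, Omega z -> wder phi z = rho z * 'D_e phi z}.
Proof.
move=> tphi; have hw := test_weak_partial axe tphi; have Hp := test_C1 axe tphi.
split; last exact: wder_ae.
apply: W12_intro (C1_L2 Hp) hw _.
exact: (L2_bounded_mul mO mrho rho_norm1 (C1_derive_L2 Hp)).
Qed.

(** Weak differentiation is a closed operator: the identity
    [int u_n D phi = - int (rho D u_n) (phi / rho)] equates two L^2 products,
    [phi / rho] being square integrable since [1 / rho] is, and both pass to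
    the limit. *)
Lemma wder_closed (u_ : nat -> R * R -> R) u g : (forall n, W12 (u_ n)) ->
  L2O u -> L2O g -> L2cvg mu Omega u_ u -> L2cvg mu Omega (fun n => wder (u_ n)) g ->
  W12 u /\ {ae mu, forall z, Omega z -> wder u z = g z}.
Proof.
move=> Wu_ Lu Lg cu cg.
have gE z : Omega z -> rho z * (g z * (rho z)^-1) = g z.
  by move=> Oz; rewrite mulrCA mulfV ?mulr1// gt_eqF// rho0.
have mginv : measurable_fun (Omega : set plane) (fun z => g z * (rho z)^-1).
  by apply: measurable_funM; [exact: Lg.1|exact: Lrho.1].
have hw : is_weak_partial e u (fun z => g z * (rho z)^-1).
  split; first exact: L2_locally_integrable.
    apply: integrable_locally_integrable; exact: (L2_integrableM mO Lg Lrho).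
  move=> phi tphi; have Hp := test_C1 axe tphi.
  have [cphi _ _ [K [cK _ pK]]] := Hp; have [M phiM] := support_bounded cK cphi pK.
  have mphi : measurable_fun (Omega : set plane) phi.
    by apply: measurable_funTS; exact: continuous_measurable2 cphi.
  have Lphi : L2O (fun z => phi z * (rho z)^-1).
    by apply: (L2_bounded_mul mO mphi _ Lrho) => z _; exact: phiM.
  have c1 := L2cvg_dot mO (fun n => let: And3 L _ _ := Wu_ n in L) Lu (C1_derive_L2 Hp) cu.
  have c2 := L2cvg_dot mO (fun n => let: And3 _ _ L := Wu_ n in L) Lg Lphi cg.
  have -> : \int[mu]_(z in Omega) (g z * (rho z)^-1 * phi z) = dotO g (fun z => phi z * (rho z)^-1).
    by apply: eq_Rintegral => z _; ring.
  apply: (cvg_unique _ c1) => //.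
  rewrite (_ : (fun n => dotO (u_ n) ('D_e phi)) =
     (fun n => - dotO (wder (u_ n)) (fun z => phi z * (rho z)^-1))); first exact: cvgN.
  apply/funext => n; have [_ /weak_partialP[_ _ h] _] := Wu_ n.
  rewrite /dot h//; congr (- _); apply: eq_Rintegral => z; rewrite inE => Oz.
  by rewrite /wder; field; rewrite gt_eqF// rho0.
split; last by apply: filterS (wder_ae hw) => z h Oz; rewrite h// gE.
apply: W12_intro hw _ => //.
apply: (L2_ae mO _ _ Lg); first exact: (measurable_funM mrho mginv).
by apply: aeW => z Oz; rewrite gE.
Qed.

End weighted_weak_derivative.

(** * Integrability of the inverse weights *)

Section weights.
Context {R : realType}.
Local Notation plane := (measurableTypeR R * measurableTypeR R)%type.
Local Notation mu := (@leb2 R).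
Local Notation leb := (@lebesgue_measure R).
Local Notation L2O := (L2 mu Omega).
Local Notation dotO := (dot mu Omega).
Let mO := @measurable_Omega R.
Let I01 : set R := `]0, 1[%classic.

Lemma integral_Omega_snd (g : R -> R) : measurable_fun (setT : set (measurableTypeR R)) g ->
  (forall y, 0 <= g y) ->
  (\int[mu]_(z in Omega) (g z.2)%:E = \int[leb]_(y in `]0%R, 1%R[) (g y)%:E)%E.
Proof.
move=> mg g0.
have mgs : measurable_fun (setT : set plane) (fun z => (g z.2)%:E).
  by apply/measurable_EFinP; exact: (measurableT_comp mg measurable_snd).
have mp : measurable_fun (setT : set plane) ((fun z : plane => (g z.2)%:E) \_ Omega).
  by apply/(measurable_restrictT _ mO); exact: measurable_funTS.
have p0 z : (0 <= ((fun z : plane => (g z.2)%:E) \_ Omega) z)%E.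
  by rewrite patchE; case: ifPn => // _; rewrite lee_fin.
rewrite integral_mkcond [RHS]integral_mkcond.
have -> := @fubini_tonelli2 _ _ _ _ R leb leb _ mp p0.
apply: eq_integral => y _; rewrite /fubini_G patchE.
have [Iy|nIy] := pselect (I01 y).
  rewrite mem_set//.
  transitivity (\int[leb]_(x in I01) (cst (g y)%:E x))%E; last first.
    rewrite integral_cst//=; last exact: measurable_itv.
    by rewrite lebesgue_measure_itv /= lte_fin ltr01 sube0 mule1.
  rewrite [RHS]integral_mkcond; apply: eq_integral => x _; rewrite !patchE.
  have [Ix|nIx] := pselect (I01 x); first by rewrite !mem_set.
  by rewrite !memNset// => -[].
rewrite memNset//; apply: integral0_eq => x _; rewrite patchE memNset// => -[//].
Qed.

Lemma integral_Omega_fst (g : R -> R) : measurable_fun (setT : set (measurableTypeR R)) g ->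
  (forall y, 0 <= g y) ->
  (\int[mu]_(z in Omega) (g z.1)%:E = \int[leb]_(y in `]0%R, 1%R[) (g y)%:E)%E.
Proof.
move=> mg g0.
have mgs : measurable_fun (setT : set plane) (fun z => (g z.1)%:E).
  by apply/measurable_EFinP; exact: (measurableT_comp mg measurable_fst).
have mp : measurable_fun (setT : set plane) ((fun z : plane => (g z.1)%:E) \_ Omega).
  by apply/(measurable_restrictT _ mO); exact: measurable_funTS.
have p0 z : (0 <= ((fun z : plane => (g z.1)%:E) \_ Omega) z)%E.
  by rewrite patchE; case: ifPn => // _; rewrite lee_fin.
rewrite integral_mkcond [RHS]integral_mkcond.
have -> := @fubini_tonelli1 _ _ _ _ R leb leb _ mp p0.
apply: eq_integral => x _; rewrite /fubini_F patchE.
have [Ix|nIx] := pselect (I01 x).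
  rewrite mem_set//.
  transitivity (\int[leb]_(y in I01) (cst (g x)%:E y))%E; last first.
    rewrite integral_cst//=; last exact: measurable_itv.
    by rewrite lebesgue_measure_itv /= lte_fin ltr01 sube0 mule1.
  rewrite [RHS]integral_mkcond; apply: eq_integral => y _; rewrite !patchE.
  have [Iy|nIy] := pselect (I01 y); first by rewrite !mem_set.
  by rewrite !memNset// => -[].
rewrite memNset//; apply: integral0_eq => y _; rewrite patchE memNset// => -[//].
Qed.

Lemma powRN_sqr (a y : R) : ((y `^ a)^-1) ^+ 2 = y `^ (- (2 * a)).
Proof.
rewrite -powRN -powR_mulrn ?powR_ge0// -powRrM.
by congr powR; ring.
Qed.

Lemma powR_itv01 (a y : R) : 0 < a -> I01 y -> 0 < y `^ a <= 1.
Proof.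
move=> a0; rewrite /I01 /= in_itv /= => /andP[y0 y1].
rewrite powR_gt0//= (_ : 1 = 1 `^ a); last by rewrite powR1.
by apply: ge0_ler_powR; rewrite ?nnegrE ?ler01 ?ltW.
Qed.

(** The square of the inverse weight has exponent [- 2 a > - 1]. *)
Lemma L2_inv_powR_snd (a : R) : 0 < a < 2^-1 -> L2O (fun z => (z.2 `^ a)^-1).
Proof.
move=> ha; apply: L2_lty.
  apply: measurable_funTS.
  rewrite (_ : (fun z => _) = (fun z : plane => z.2 `^ (- a))); last first.
    by apply/funext => z; rewrite powRN.
  exact: (measurableT_comp (measurable_powR (- a)) measurable_snd).
rewrite (eq_integral (fun z : plane => (z.2 `^ (- (2 * a)))%:E)); last first.
  by move=> z _; rewrite powRN_sqr.
rewrite (integral_Omega_snd (g := fun y => y `^ (- (2 * a)))).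
- by apply: integral_powRN_lty; lra.
- exact: measurable_powR.
- by move=> y; exact: powR_ge0.
Qed.

Lemma L2_inv_powR_fst (a : R) : 0 < a < 2^-1 -> L2O (fun z => (z.1 `^ a)^-1).
Proof.
move=> ha; apply: L2_lty.
  apply: measurable_funTS.
  rewrite (_ : (fun z => _) = (fun z : plane => z.1 `^ (- a))); last first.
    by apply/funext => z; rewrite powRN.
  exact: (measurableT_comp (measurable_powR (- a)) measurable_fst).
rewrite (eq_integral (fun z : plane => (z.1 `^ (- (2 * a)))%:E)); last first.
  by move=> z _; rewrite powRN_sqr.
rewrite (integral_Omega_fst (g := fun y => y `^ (- (2 * a)))).
- by apply: integral_powRN_lty; lra.
- exact: measurable_powR.
- by move=> y; exact: powR_ge0.
Qed.

End weights.

(** * The degenerate Sobolev spaces and the Poincare inequality *)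

Lemma sqrt_bound (R : rcfType) (X Y p q c d : R) : 0 <= X -> 0 <= Y ->
  0 <= p -> 0 <= q -> 0 <= c -> 0 <= d -> X ^+ 2 <= p * c -> Y ^+ 2 <= q * d ->
  X * Y <= Num.sqrt (c * d) * (p + q).
Proof.
move=> X0 Y0 p0 q0 c0 d0 hX hY; have pq0 : 0 <= p + q by rewrite addr_ge0.
have cd0 : 0 <= c * d by rewrite mulr_ge0.
rewrite -[leRHS]ger0_norm ?mulr_ge0 ?sqrtr_ge0// -[leLHS]ger0_norm ?mulr_ge0//.
rewrite -ler_sqr ?nnegrE// !real_normK ?num_real// !exprMn sqr_sqrtr//.
apply: (le_trans (ler_pM (sqr_ge0 _) (sqr_ge0 _) hX hY)).
rewrite mulrACA [leLHS]mulrC ler_wpM2l//.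
have := sqr_ge0 p; have := sqr_ge0 q; have : 0 <= p * q by rewrite mulr_ge0.
by lra.
Qed.

Section degenerate_sobolev.
Context {R : realType}.
Variables (a1 a2 : R).
Hypotheses (ha1 : 0 < a1 < 2^-1) (ha2 : 0 < a2 < 2^-1).
Local Notation plane := (measurableTypeR R * measurableTypeR R)%type.
Local Notation mu := (@leb2 R).
Local Notation L2O := (L2 mu Omega).
Local Notation dotO := (dot mu Omega).
Let mO := @measurable_Omega R.
Implicit Types (u v w phi : R * R -> R).

Let rx (z : R * R) : R := z.2 `^ a1.
Let ry (z : R * R) : R := z.1 `^ a2.

Let mrx : measurable_fun (Omega : set plane) rx.
Proof. by apply: measurable_funTS; exact: (measurableT_comp (measurable_powR a1) measurable_snd). Qed.
Let mry : measurable_fun (Omega : set plane) ry.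
Proof. by apply: measurable_funTS; exact: (measurableT_comp (measurable_powR a2) measurable_fst). Qed.
Let rx01 z : Omega z -> 0 < rx z <= 1.
Proof. by move=> [_ h]; apply: powR_itv01 => //; case/andP: ha1. Qed.
Let ry01 z : Omega z -> 0 < ry z <= 1.
Proof. by move=> [h _]; apply: powR_itv01 => //; case/andP: ha2. Qed.
Let rx0 z : Omega z -> 0 < rx z. Proof. by move/rx01/andP => []. Qed.
Let rx1 z : Omega z -> rx z <= 1. Proof. by move/rx01/andP => []. Qed.
Let ry0 z : Omega z -> 0 < ry z. Proof. by move/ry01/andP => []. Qed.
Let ry1 z : Omega z -> ry z <= 1. Proof. by move/ry01/andP => []. Qed.
Let Lrx : L2O (fun z => (rx z)^-1). Proof. exact: L2_inv_powR_snd. Qed.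
Let Lry : L2O (fun z => (ry z)^-1). Proof. exact: L2_inv_powR_fst. Qed.
Let axx : axis (@ex R). Proof. by left. Qed.
Let axy : axis (@ey R). Proof. by right. Qed.

Lemma H1P u : H1 a1 a2 u <-> W12 ex rx u /\ W12 ey ry u.
Proof.
split=> [[/Lp2P Lu [hx /Lp2P Lx] [hy /Lp2P Ly]]|[[Lu hx Lx] [_ hy Ly]]].
  by split; [exact: (And3 Lu hx Lx)|exact: (And3 Lu hy Ly)].
exact: (And3 ((Lp2P u).2 Lu) (conj hx ((Lp2P _).2 Lx)) (conj hy ((Lp2P _).2 Ly))).
Qed.

Lemma H1_comb u t v : H1 a1 a2 u -> H1 a1 a2 v -> H1 a1 a2 (comb u t v).
Proof.
move=> /H1P[ux uy] /H1P[vx vy]; apply/H1P; split; [exact: W12_comb|exact: W12_comb].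
Qed.

Lemma wdx_ae_linear : ae_linear mu Omega (H1 a1 a2) (wdx a1).
Proof.
have [L l] := wder_ae_linear rx axx; split=> [u /H1P[ux _]|u t v /H1P[ux _] /H1P[vx _]].
  exact: L.
exact: l.
Qed.

Lemma wdy_ae_linear : ae_linear mu Omega (H1 a1 a2) (wdy a2).
Proof.
have [L l] := wder_ae_linear ry axy; split=> [u /H1P[_ uy]|u t v /H1P[_ uy] /H1P[_ vy]].
  exact: L.
exact: l.
Qed.

Lemma id_ae_linear : ae_linear mu Omega (H1 a1 a2) id.
Proof. by split=> [u /H1P[[]]//|u t v _ _]; exact: aeW. Qed.

Definition energy u v : R := dotO (wdx a1 u) (wdx a1 v) + dotO (wdy a2 u) (wdy a2 v).

Definition h1dot u v : R := dotO u v + energy u v.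

Lemma energy_psd : psd_form (H1 a1 a2) energy.
Proof.
exact: (psd_add (psd_pullback mO H1_comb wdx_ae_linear)
  (psd_pullback mO H1_comb wdy_ae_linear)).
Qed.

Lemma h1dot_psd : psd_form (H1 a1 a2) h1dot.
Proof.
exact: (psd_add (psd_pullback mO H1_comb id_ae_linear) energy_psd).
Qed.

Lemma H1_norm_sqr u : H1 a1 a2 u -> H1_norm a1 a2 u = Num.sqrt (h1dot u u).
Proof.
move=> /H1P[[Lu _ Lx] [_ _ Ly]].
rewrite /H1_norm /h1dot /energy addrA; congr (Num.sqrt (_ + _ + _)).
- exact: (Lp_norm2 Lu).
- exact: (Lp_norm2 (f := wdx a1 u) Lx).
- exact: (Lp_norm2 (f := wdy a2 u) Ly).
Qed.

Lemma test_H1 phi : test_function phi -> H1 a1 a2 phi.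
Proof.
move=> tphi; apply/H1P; split.
  by have [] := test_W12 axx mrx rx0 rx1 tphi.
by have [] := test_W12 axy mry ry0 ry1 tphi.
Qed.

(** On [H1] the norm is the square root of a quadratic form, to which the
    algebra of semidefinite forms applies. *)
Lemma H1_0P u : H1_0 a1 a2 u <-> H1 a1 a2 u /\ forall eps : R, 0 < eps ->
  exists2 phi, test_function phi & h1dot (comb u (-1) phi) (comb u (-1) phi) < eps.
Proof.
have subE phi : u \- phi = comb u (-1) phi.
  by apply/funext => z; rewrite /comb mulN1r.
split=> -[Hu approx]; split => // eps eps0.
  have [|phi tphi] := approx (Num.sqrt eps); first by rewrite sqrtr_gt0.
  rewrite subE (H1_norm_sqr (H1_comb (-1) Hu (test_H1 tphi))).
  by rewrite ltr_sqrt// => h; exists phi.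
have [|phi tphi h] := approx (eps ^+ 2); first by rewrite exprn_gt0.
exists phi; first exact: tphi.
rewrite subE (H1_norm_sqr (H1_comb (-1) Hu (test_H1 tphi))).
by rewrite -(ger0_norm (ltW eps0)) -sqrtr_sqr ltr_sqrt// exprn_gt0.
Qed.

Lemma H1_0_comb u t v : H1_0 a1 a2 u -> H1_0 a1 a2 v -> H1_0 a1 a2 (comb u t v).
Proof.
move=> /H1_0P[Hu au] /H1_0P[Hv av]; apply/H1_0P; split; first exact: H1_comb.
move=> eps eps0.
have t0 : 0 < 1 + t ^+ 2 by rewrite ltr_pwDl// sqr_ge0.
have [phi tphi hphi] := au (eps / 4) ltac:(lra).
have [psi tpsi hpsi] := av (eps / (4 * (1 + t ^+ 2))) ltac:(rewrite divr_gt0//; lra).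
exists (comb phi t psi); first exact: test_comb.
have Hd1 := H1_comb (-1) Hu (test_H1 tphi); have Hd2 := H1_comb (-1) Hv (test_H1 tpsi).
rewrite (_ : comb (comb u t v) (-1) (comb phi t psi) =
  comb (comb u (-1) phi) t (comb v (-1) psi)); last first.
  by apply/funext => z; rewrite /comb; ring.
apply: le_lt_trans (psd_comb_le h1dot_psd t Hd1 Hd2) _.
have h3 : (1 + t ^+ 2) * h1dot (comb v (-1) psi) (comb v (-1) psi) < eps / 4.
  move: hpsi; rewrite ltr_pdivlMr; last by lra.
  by move: (h1dot _ _) => k; lra.
have := psd_ge0 h1dot_psd Hd2.
by move: hphi h3; move: (h1dot _ _) (h1dot _ _) => k l; lra.
Qed.

Lemma test_H1_0 phi : test_function phi -> H1_0 a1 a2 phi.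
Proof.
move=> tphi; have Hphi := test_H1 tphi; apply/H1_0P; split => // eps eps0.
exists phi => //; rewrite (psd_sq h1dot_psd)//.
by rewrite (_ : _ + _ = 0)//; ring.
Qed.

(** [|D phi| = |rho D phi| (1 / rho)] and [1 / rho] is square integrable, so
    the Cauchy-Schwarz inequality bounds the two factors of
    [gagliardo_nirenberg] by the weighted derivatives. *)
Lemma poincare_test : exists2 C : R, 0 <= C & forall phi, test_function phi ->
  dotO phi phi <= C * energy phi phi.
Proof.
pose cx := dotO (fun z => (rx z)^-1) (fun z => (rx z)^-1).
pose cy := dotO (fun z => (ry z)^-1) (fun z => (ry z)^-1).
have cx0 : 0 <= cx by exact: dot_ge0.
have cy0 : 0 <= cy by exact: dot_ge0.
exists (Num.sqrt (cx * cy)); first exact: sqrtr_ge0.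
move=> phi tphi.
have L1 (e : R * R) (rho : R * R -> R) : axis e -> measurable_fun (Omega : set plane) rho ->
    (forall z, Omega z -> 0 < rho z) -> (forall z, Omega z -> rho z <= 1) ->
    L2O (fun z => (rho z)^-1) ->
    (\int[mu]_(z in Omega) `|'D_e phi z|) ^+ 2 <=
    dotO (wder e rho phi) (wder e rho phi) * dotO (fun z => (rho z)^-1) (fun z => (rho z)^-1).
  move=> axe mr r0 r1 Lr; have [Wp aeW'] := test_W12 axe mr r0 r1 tphi.
  have LD := C1_derive_L2 (test_C1 axe tphi).
  have LrD : L2O (fun z => rho z * 'D_e phi z).
    exact: (L2_bounded_mul mO mr (rho_norm1 r0 r1) LD).
  have LrA : L2O (fun z => `|rho z * 'D_e phi z|).
    apply: L2_lty; first by exact: (measurableT_comp (@normr_measurable _ setT) LrD.1).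
    under eq_integral do rewrite real_normK ?num_real//.
    by rewrite -dotE// ltry.
  have -> : dotO (wder e rho phi) (wder e rho phi) =
      dotO (fun z => `|rho z * 'D_e phi z|) (fun z => `|rho z * 'D_e phi z|).
    transitivity (dotO (fun z => rho z * 'D_e phi z) (fun z => rho z * 'D_e phi z)).
      by apply: (dot_ae mO) => //; case: Wp.
    by apply: eq_Rintegral => z _; rewrite -!expr2 real_normK ?num_real.
  have -> : \int[mu]_(z in Omega) `|'D_e phi z| =
      dotO (fun z => `|rho z * 'D_e phi z|) (fun z => (rho z)^-1).
    apply: eq_Rintegral => z; rewrite inE => Oz; have rz := r0 _ Oz.
    by rewrite normrM (gtr0_norm rz) mulrAC mulfV ?mul1r// gt_eqF.
  exact: dot_cauchy_schwarz.
have hx := L1 _ _ axx mrx rx0 rx1 Lrx; have hy := L1 _ _ axy mry ry0 ry1 Lry.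
have gn := gagliardo_nirenberg (test_C1 axx tphi) (test_C1 axy tphi).
apply: (le_trans gn); rewrite /energy.
have Hphi := test_H1 tphi.
apply: sqrt_bound.
- by apply: Rintegral_ge0 => z _.
- by apply: Rintegral_ge0 => z _.
- exact: (dot_ge0 mO (wdx_ae_linear.1 _ Hphi)).
- exact: (dot_ge0 mO (wdy_ae_linear.1 _ Hphi)).
- exact: cx0.
- exact: cy0.
- exact: hx.
- exact: hy.
Qed.

(** Both sides are continuous for the norm of [H1], in which test functions
    approximate the elements of [H1_0]. *)
Lemma poincare : exists2 C : R, 0 <= C & forall u, H1_0 a1 a2 u -> dotO u u <= C * energy u u.
Proof.
have [C C0 CP] := poincare_test; exists (4 * C); first by rewrite mulr_ge0.
move=> u /H1_0P[Hu au]; apply/ler_addgt0Pr => eps; move: (eps : R) => {}eps eps0.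
have C1 : 0 < 2 + 4 * C by lra.
have [phi tphi hphi] := au (eps / (2 + 4 * C)) ltac:(exact: divr_gt0).
have Hphi := test_H1 tphi; have Hd := H1_comb (-1) Hu Hphi.
have LP : psd_form (H1 a1 a2) dotO := psd_pullback mO H1_comb id_ae_linear.
have uE : u = comb (comb u (-1) phi) 1 phi by apply/funext => z; rewrite /comb; ring.
have phiE : phi = comb u (-1) (comb u (-1) phi) by apply/funext => z; rewrite /comb; ring.
have h1 := psd_comb_le LP 1 Hd Hphi; rewrite -uE in h1.
have h2 := psd_comb_le energy_psd (-1) Hu Hd; rewrite -phiE in h2.
have h3 := CP _ tphi.
have d0 := psd_ge0 LP Hd; have e0 := psd_ge0 energy_psd Hd.
move: hphi; rewrite /h1dot ltr_pdivlMr// => h4.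
move: h1 h2 h3 h4 d0 e0.
move: (dotO (comb u (-1) phi) (comb u (-1) phi)) => d.
move: (energy (comb u (-1) phi) (comb u (-1) phi)) => ed.
move: (dotO u u) (dotO phi phi) (energy u u) (energy phi phi).
move=> uu pp eu ep h1 h2 h3 h4 d0 e0.
have h5 : C * ep <= C * (2 * eu + 2 * (-1) ^+ 2 * ed) by rewrite ler_wpM2l.
have : 0 <= C * d by rewrite mulr_ge0.
have : 0 <= C * ed by rewrite mulr_ge0.
by lra.
Qed.

Lemma H1_closed (u_ : nat -> R * R -> R) u gx gy : (forall n, H1 a1 a2 (u_ n)) ->
  L2O u -> L2O gx -> L2O gy -> L2cvg mu Omega u_ u ->
  L2cvg mu Omega (fun n => wdx a1 (u_ n)) gx -> L2cvg mu Omega (fun n => wdy a2 (u_ n)) gy ->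
  [/\ H1 a1 a2 u, {ae mu, forall z, Omega z -> wdx a1 u z = gx z} &
    {ae mu, forall z, Omega z -> wdy a2 u z = gy z}].
Proof.
move=> Hu_ Lu Lgx Lgy cu cx cy.
have [Wx ex] := wder_closed axx mrx rx0 Lrx (fun n => ((H1P _).1 (Hu_ n)).1) Lu Lgx cu cx.
have [Wy ey] := wder_closed axy mry ry0 Lry (fun n => ((H1P _).1 (Hu_ n)).2) Lu Lgy cu cy.
split; [by apply/H1P; split|exact: ex|exact: ey].
Qed.

End degenerate_sobolev.

(** * The form with potential and the weak solution *)

Lemma parts_le (R : realFieldType) (C d x y v : R) : 0 <= C -> 0 <= x -> 0 <= y -> 0 <= v ->
  d <= C * (x + y) ->
  [/\ d <= C * (x + y + v), x <= x + y + v, y <= x + y + v & v <= x + y + v].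
Proof.
move=> C0 x0 y0 v0 h; split; [|by lra..].
by apply: le_trans h _; rewrite ler_wpM2l// lerDl.
Qed.

Lemma approx_lt (R : realFieldType) (eps d x y h : R) : d <= eps / 12 -> x <= eps / 12 ->
  y <= eps / 12 -> h < eps / 4 -> 2 * (d + (x + y)) + 2 * 1 ^+ 2 * h < eps.
Proof. by lra. Qed.

Section schroedinger.
Context {R : realType}.
Variables (a1 a2 : R) (V : R * R -> R).
Hypotheses (ha1 : 0 < a1 < 2^-1) (ha2 : 0 < a2 < 2^-1).
Local Notation plane := (measurableTypeR R * measurableTypeR R)%type.
Local Notation mu := (@leb2 R).
Local Notation L2O := (L2 mu Omega).
Local Notation dotO := (dot mu Omega).
Hypotheses (mV : measurable_fun (Omega : set plane) V)
  (V0 : {ae mu, forall z, Omega z -> 0 <= V z}).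
Let mO := @measurable_Omega R.
Implicit Types (u v w phi f : R * R -> R).

(** Turns the potential term of the form into an L^2 product.  Where [V] is
    negative, which happens on a null set, [Num.sqrt] is 0. *)
Definition sqrtV u : R * R -> R := fun z => Num.sqrt (V z) * u z.

Lemma measurable_sqrtV u : measurable_fun (Omega : set plane) u ->
  measurable_fun (Omega : set plane) (sqrtV u).
Proof.
move=> mu_; apply: measurable_funM => //.
exact: (measurableT_comp (continuous_measurable_fun (@sqrt_continuous R)) mV).
Qed.

Lemma sqrtV_mul u v : {ae mu, forall z, Omega z -> V z * u z * v z = sqrtV u z * sqrtV v z}.
Proof.
apply: filterS V0 => z h /h V0z; rewrite /sqrtV -[in LHS](sqr_sqrtr V0z); ring.
Qed.

Let H1_L2 u : H1 a1 a2 u -> L2O u.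
Proof. by move=> /H1P[[]]. Qed.
Let H1_0_H1 u : H1_0 a1 a2 u -> H1 a1 a2 u. Proof. by case. Qed.

Lemma H_0P u : H_0 a1 a2 V u <-> H1_0 a1 a2 u /\ L2O (sqrtV u).
Proof.
have E : H1_0 a1 a2 u ->
    (\int[mu]_(z in Omega) (V z * u z ^+ 2)%:E = \int[mu]_(z in Omega) (sqrtV u z ^+ 2)%:E)%E.
  move=> /H1_0_H1/H1_L2[mu_ _]; apply: ae_eq_integral => //.
  - by apply/measurable_EFinP; apply: measurable_funM => //; exact: measurable_funX.
  - by apply/measurable_EFinP; apply: measurable_funX; exact: measurable_sqrtV.
  - by apply: filterS (sqrtV_mul u u) => z h /h hz; rewrite !expr2 mulrA hz.
split=> [[Hu Vu]|[Hu Lu]]; split => //.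
  apply: L2_lty; last by rewrite -E.
  by have [mu_ _] := H1_L2 (H1_0_H1 Hu); exact: measurable_sqrtV.
by rewrite E// -dotE// ltry.
Qed.

Let H_0_H1 u : H_0 a1 a2 V u -> H1 a1 a2 u. Proof. by case=> -[]. Qed.

Lemma sqrtV_comb u t v : sqrtV (comb u t v) = comb (sqrtV u) t (sqrtV v).
Proof. by apply/funext => z; rewrite /sqrtV /comb; ring. Qed.

Lemma H_0_comb u t v : H_0 a1 a2 V u -> H_0 a1 a2 V v -> H_0 a1 a2 V (comb u t v).
Proof.
move=> /H_0P[Hu Lu] /H_0P[Hv Lv]; apply/H_0P; split; first exact: H1_0_comb.
by rewrite sqrtV_comb; exact: (L2_comb mO).
Qed.

Lemma sqrtV_ae_linear : ae_linear mu Omega (H_0 a1 a2 V) sqrtV.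
Proof.
split=> [u /H_0P[]//|u t v _ _]; apply: aeW => z _; by rewrite sqrtV_comb.
Qed.

Definition aform u v : R := energy a1 a2 u v + dotO (sqrtV u) (sqrtV v).

Lemma aform_psd : psd_form (H_0 a1 a2 V) aform.
Proof.
exact: (psd_add (psd_restrict (energy_psd a1 a2) H_0_H1 H_0_comb)
  (psd_pullback mO H_0_comb sqrtV_ae_linear)).
Qed.

Lemma a_formE u v : H_0 a1 a2 V u -> H_0 a1 a2 V v -> a_form a1 a2 V u v = aform u v.
Proof.
move=> Hu Hv; have [Lx _] := wdx_ae_linear a1 a2; have [Ly _] := wdy_ae_linear a1 a2.
have [_ Vu] := (H_0P u).1 Hu; have [_ Vv] := (H_0P v).1 Hv.
have mu_ : measurable_fun (Omega : set plane) u by exact: (H1_L2 (H_0_H1 Hu)).1.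
have mv : measurable_fun (Omega : set plane) v by exact: (H1_L2 (H_0_H1 Hv)).1.
have ix := L2_integrableM mO (Lx _ (H_0_H1 Hu)) (Lx _ (H_0_H1 Hv)).
have iy := L2_integrableM mO (Ly _ (H_0_H1 Hu)) (Ly _ (H_0_H1 Hv)).
have iV := L2_integrableM mO Vu Vv.
rewrite /aform /energy /dot -(RintegralD mO ix iy).
rewrite -(RintegralD mO (integrableD mO ix iy) iV).
apply: (Rintegral_ae mO).
- apply: measurable_funD.
    by apply/measurable_EFinP; exact: measurable_int (integrableD mO ix iy).
  by apply: measurable_funM => //; exact: measurable_funM.
- apply: measurable_funD.
    by apply/measurable_EFinP; exact: measurable_int (integrableD mO ix iy).
  by apply/measurable_EFinP; exact: measurable_int iV.
- by apply: filterS (sqrtV_mul u v) => z h /h ->.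
Qed.

(** A Cauchy sequence for the form is Cauchy in L^2 together with its weighted
    derivatives, by the Poincare inequality, and with its products by
    [sqrt V]. *)
Lemma H_0_complete (u_ : nat -> R * R -> R) : (forall n, H_0 a1 a2 V (u_ n)) ->
  (forall eps : R, 0 < eps -> exists N, forall m n, (N <= m)%N -> (N <= n)%N ->
     aform (comb (u_ m) (-1) (u_ n)) (comb (u_ m) (-1) (u_ n)) <= eps) ->
  exists2 u, H_0 a1 a2 V u & forall (eps : R) N, 0 < eps -> exists2 n, (N <= n)%N &
     aform (comb u (-1) (u_ n)) (comb u (-1) (u_ n)) <= eps.
Proof.
move=> Hu_ cu; have [C C0 CP] := poincare ha1 ha2.
have Lx := wdx_ae_linear a1 a2; have Ly := wdy_ae_linear a1 a2; have LV := sqrtV_ae_linear.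
have H1u n : H1 a1 a2 (u_ n) := H_0_H1 (Hu_ n).
have parts u : H_0 a1 a2 V u -> [/\ dotO u u <= C * aform u u,
    dotO (wdx a1 u) (wdx a1 u) <= aform u u, dotO (wdy a2 u) (wdy a2 u) <= aform u u &
    dotO (sqrtV u) (sqrtV u) <= aform u u].
  move=> Hu; have [H10 _] := Hu.
  have x0 := dot_ge0 mO (Lx.1 _ (H_0_H1 Hu)); have y0 := dot_ge0 mO (Ly.1 _ (H_0_H1 Hu)).
  have v0 := dot_ge0 mO (LV.1 _ Hu); have := CP _ H10; rewrite /aform /energy => h.
  exact: (parts_le C0 x0 y0 v0 h).
have Hd m n : H_0 a1 a2 V (comb (u_ m) (-1) (u_ n)) by exact: H_0_comb.
have [u [Lu cvu [sigma sid aeu]]] : exists g, [/\ L2O g, L2cvg mu Omega u_ g &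
    exists2 sigma : nat -> nat, (forall n, (n <= sigma n)%N) &
      {ae mu, forall z, Omega z -> u_ (sigma n) z @[n --> \oo] --> g z}].
  apply: (L2_complete mO leb2_Omega_lty) => [n|eps eps0]; first exact: H1_L2.
  have [N NP] := cu (eps / (1 + C)) ltac:(by rewrite divr_gt0// ltr_pwDl).
  exists N => m n Nm Nn; have [h _ _ _] := parts _ (Hd m n).
  have := NP m n Nm Nn; rewrite ler_pdivlMr ?ltr_pwDl// => h'.
  by have := psd_ge0 aform_psd (Hd m n); lra.
have [gx [Lgx cvx _]] : exists g, [/\ L2O g, L2cvg mu Omega (fun n => wdx a1 (u_ n)) g &
    exists2 sigma : nat -> nat, (forall n, (n <= sigma n)%N) &
      {ae mu, forall z, Omega z -> wdx a1 (u_ (sigma n)) z @[n --> \oo] --> g z}].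
  apply: (L2_complete mO leb2_Omega_lty (f_ := fun n => wdx a1 (u_ n))) => [n|eps eps0].
    exact: Lx.1.
  have [N NP] := cu eps eps0; exists N => m n Nm Nn; have [_ h _ _] := parts _ (Hd m n).
  rewrite -(dist_comb mO (@H1_comb _ a1 a2) Lx (H1u m) (H1u n)).
  exact: le_trans h (NP m n Nm Nn).
have [gy [Lgy cvy _]] : exists g, [/\ L2O g, L2cvg mu Omega (fun n => wdy a2 (u_ n)) g &
    exists2 sigma : nat -> nat, (forall n, (n <= sigma n)%N) &
      {ae mu, forall z, Omega z -> wdy a2 (u_ (sigma n)) z @[n --> \oo] --> g z}].
  apply: (L2_complete mO leb2_Omega_lty (f_ := fun n => wdy a2 (u_ n))) => [n|eps eps0].
    exact: Ly.1.
  have [N NP] := cu eps eps0; exists N => m n Nm Nn; have [_ _ h _] := parts _ (Hd m n).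
  rewrite -(dist_comb mO (@H1_comb _ a1 a2) Ly (H1u m) (H1u n)).
  exact: le_trans h (NP m n Nm Nn).
(* along sigma, u_ converges almost everywhere, which identifies k with sqrtV u below *)
have [k [Lk cvk [tau tid aek]]] : exists g, [/\ L2O g,
    L2cvg mu Omega (fun n => sqrtV (u_ (sigma n))) g &
    exists2 tau : nat -> nat, (forall n, (n <= tau n)%N) &
      {ae mu, forall z, Omega z -> sqrtV (u_ (sigma (tau n))) z @[n --> \oo] --> g z}].
  apply: (L2_complete mO leb2_Omega_lty (f_ := fun n => sqrtV (u_ (sigma n)))) => [n|eps eps0].
    exact: LV.1.
  have [N NP] := cu eps eps0; exists N => m n Nm Nn.
  have [_ _ _ h] := parts _ (Hd (sigma m) (sigma n)).
  rewrite -sqrtV_comb; apply: le_trans h (NP _ _ _ _);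
    [exact: leq_trans (sid m)|exact: leq_trans (sid n)].
have [H1lim aex aey] := H1_closed ha1 ha2 H1u Lu Lgx Lgy cvu cvx cvy.
have kE : {ae mu, forall z, Omega z -> k z = sqrtV u z}.
  apply: filterS2 aeu aek => z hu hk Oz; have {}hu := hu Oz; have {}hk := hk Oz.
  apply: (cvg_unique _ hk) => //; apply: cvgM; first exact: cvg_cst.
  have ctau : tau n @[n --> \oo] --> \oo.
    by apply/cvgnyPge => A; exists A => // n /= An; exact: leq_trans (tid n).
  exact: (cvg_comp tau (fun n => u_ (sigma n) z) ctau hu).
have LVu : L2O (sqrtV u).
  by apply: (L2_ae mO _ kE Lk); apply: measurable_sqrtV; exact: Lu.1.
have cvV := L2cvg_ae mO (fun n => LV.1 _ (Hu_ (sigma n))) Lk LVu kE cvk.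
have wxE : {ae mu, forall z, Omega z -> gx z = wdx a1 u z}.
  by apply: filterS aex => z h /h.
have wyE : {ae mu, forall z, Omega z -> gy z = wdy a2 u z}.
  by apply: filterS aey => z h /h.
have cvwx := L2cvg_ae mO (fun n => Lx.1 _ (H1u n)) Lgx (Lx.1 _ H1lim) wxE cvx.
have cvwy := L2cvg_ae mO (fun n => Ly.1 _ (H1u n)) Lgy (Ly.1 _ H1lim) wyE cvy.
have smallu := L2cvg_le mO cvu (fun n => H1_L2 (H1u n)) Lu.
have smallx := L2cvg_le mO cvwx (fun n => Lx.1 _ (H1u n)) (Lx.1 _ H1lim).
have smally := L2cvg_le mO cvwy (fun n => Ly.1 _ (H1u n)) (Ly.1 _ H1lim).
have smallV := L2cvg_le mO cvV (fun n => LV.1 _ (Hu_ (sigma n))) LVu.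
have dx n := dist_comb mO (@H1_comb _ a1 a2) Lx H1lim (H1u n).
have dy n := dist_comb mO (@H1_comb _ a1 a2) Ly H1lim (H1u n).
have H10 : H1_0 a1 a2 u.
  apply/(H1_0P ha1 ha2); split => // eps eps0.
  have e4 : 0 < eps / 4 by rewrite divr_gt0.
  have e12 : 0 < eps / 12 by rewrite divr_gt0.
  have [N1 P1] := smallu _ e12; have [N2 P2] := smallx _ e12.
  have [N3 P3] := smally _ e12.
  pose n := maxn N1 (maxn N2 N3).
  have {}P1 := P1 n (leq_maxl _ _).
  have {}P2 := P2 n (leq_trans (leq_maxl _ _) (leq_maxr _ _)).
  have {}P3 := P3 n (leq_trans (leq_maxr _ _) (leq_maxr _ _)).
  have [_ /(_ _ e4)[phi tphi hphi]] := (H1_0P ha1 ha2 (u_ n)).1 (Hu_ n).1.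
  exists phi; first exact: tphi.
  have D1 := H1_comb (-1) H1lim (H1u n).
  have D2 := H1_comb (-1) (H1u n) (test_H1 ha1 ha2 tphi).
  rewrite (_ : comb u (-1) phi = comb (comb u (-1) (u_ n)) 1 (comb (u_ n) (-1) phi)); last first.
    by apply/funext => z; rewrite /comb; ring.
  apply: le_lt_trans (psd_comb_le (h1dot_psd a1 a2) 1 D1 D2) _.
  have hE : h1dot a1 a2 (comb u (-1) (u_ n)) (comb u (-1) (u_ n)) =
      dotO (comb u (-1) (u_ n)) (comb u (-1) (u_ n)) +
      (dotO (comb (wdx a1 u) (-1) (wdx a1 (u_ n))) (comb (wdx a1 u) (-1) (wdx a1 (u_ n))) +
       dotO (comb (wdy a2 u) (-1) (wdy a2 (u_ n))) (comb (wdy a2 u) (-1) (wdy a2 (u_ n)))).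
    by congr (_ + (_ + _)); [exact: dx|exact: dy].
  rewrite hE; exact: (approx_lt P1 P2 P3 hphi).
have Hu : H_0 a1 a2 V u by apply/H_0P.
exists u => // eps N eps0.
have e3 : 0 < eps / 3 by rewrite divr_gt0.
have [N1 P1] := smallx _ e3; have [N2 P2] := smally _ e3.
have [N3 P3] := smallV _ e3.
pose n := maxn N (maxn N1 (maxn N2 N3)).
have nN : (N <= n)%N by rewrite leq_maxl.
have nN1 : (N1 <= n)%N by rewrite /n !leq_max leqnn !orbT.
have nN2 : (N2 <= n)%N by rewrite /n !leq_max leqnn !orbT.
have nN3 : (N3 <= n)%N by rewrite /n !leq_max leqnn !orbT.
exists (sigma n); first exact: leq_trans (sid n).
have aE : aform (comb u (-1) (u_ (sigma n))) (comb u (-1) (u_ (sigma n))) =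
    dotO (comb (wdx a1 u) (-1) (wdx a1 (u_ (sigma n)))) (comb (wdx a1 u) (-1) (wdx a1 (u_ (sigma n)))) +
    dotO (comb (wdy a2 u) (-1) (wdy a2 (u_ (sigma n)))) (comb (wdy a2 u) (-1) (wdy a2 (u_ (sigma n)))) +
    dotO (comb (sqrtV u) (-1) (sqrtV (u_ (sigma n)))) (comb (sqrtV u) (-1) (sqrtV (u_ (sigma n)))).
  congr (_ + _ + _); [exact: dx|exact: dy|by rewrite sqrtV_comb].
rewrite aE.
have {}P1 := P1 (sigma n) (leq_trans nN1 (sid n)).
have {}P2 := P2 (sigma n) (leq_trans nN2 (sid n)).
have {}P3 := P3 n nN3.
rewrite (_ : eps = eps / 3 + eps / 3 + eps / 3); last by field.
exact: (lerD (lerD P1 P2) P3).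
Qed.

(** The Poincare inequality gives the continuity of [v |-> int f v] for the
    form, and turns [aform w w = 0] into [w = 0] for the difference [w] of two
    solutions. *)
Theorem weak_solution_exists_unique f : L2O f ->
  exists u, weak_solution a1 a2 V f u /\
    forall u', weak_solution a1 a2 V f u' -> {ae mu, forall z, Omega z -> u' z = u z}.
Proof.
move=> Lf; have [C C0 CP] := poincare ha1 ha2.
have CA u : H_0 a1 a2 V u -> dotO u u <= C * aform u u.
  move=> Hu; have [H10 Lu] := (H_0P u).1 Hu.
  apply: (le_trans (CP _ H10)); rewrite ler_wpM2l// /aform lerDl.
  exact: dot_ge0.
have L2u u : H_0 a1 a2 V u -> L2O u by move=> /H_0_H1/H1P[[]].
have nonempty : H_0 a1 a2 V !=set0.
  exists (fun=> 0); apply/H_0P; split; last first.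
    rewrite (_ : sqrtV _ = cst 0); last by apply/funext => z; rewrite /sqrtV mulr0.
    exact: (L2_cst mO 0 leb2_Omega_lty).
  (* the zero function is a test function, as the difference of a bump with itself *)
  pose b : R * R -> R := bump2 4^-1 2^-1 4^-1 2^-1 0.
  have tb : test_function b by apply: bump2_test; lra.
  rewrite (_ : (fun=> 0) = comb b (-1) b); last by apply/funext => z; rewrite /comb; ring.
  exact: (test_H1_0 ha1 ha2 (test_comb (-1) tb tb)).
have lbound u : H_0 a1 a2 V u -> dotO f u ^+ 2 <= dotO f f * C * aform u u.
  move=> Hu; apply: (le_trans (dot_cauchy_schwarz mO Lf (L2u _ Hu))).
  by rewrite -mulrA ler_wpM2l ?dot_ge0//; exact: CA.
have [u Hu uP] := riesz_representation aform_psd (l := dotO f) (C := dotO f f * C) nonempty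
  (fun u t v Hu Hv => psd_lin_r (dot_psd mu mO) t (L2u _ Hu) (L2u _ Hv) Lf)
  lbound H_0_complete.
exists u; split; first split => //.
  by move=> v Hv; rewrite a_formE// uP.
move=> u' [Hu' u'P].
have Hd : H_0 a1 a2 V (comb u' (-1) u) by exact: H_0_comb.
have d0 : aform (comb u' (-1) u) (comb u' (-1) u) = 0.
  by rewrite (psd_lin aform_psd)// uP// -a_formE// u'P//; rewrite /dot; ring.
have := CA _ Hd; rewrite d0 mulr0 => dd0.
have : dotO (comb u' (-1) u) (comb u' (-1) u) = 0.
  by apply/eqP; rewrite eq_le dd0 dot_ge0//; exact: L2u.
move/(dot0 mO (L2u _ Hd)); apply: filterS => z h /h.
by rewrite /comb mulN1r => /eqP; rewrite subr_eq0 => /eqP.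
Qed.

End schroedinger.

Theorem theorem2p12 (R : realType) (a1 a2 M p : R)
    (ha1 : 0 < a1 < 2^-1) (ha2 : 0 < a2 < 2^-1) (hM : 0 < M) (hp : 1 < p)
    (V : R * R -> R) (hV : S_ p M V) (f : R * R -> R) (hf : Lp 2 f) :
  exists u : R * R -> R, weak_solution a1 a2 V f u /\
    forall u' : R * R -> R, weak_solution a1 a2 V f u' ->
      {ae leb2, forall z, Omega z -> u' z = u z}.
Proof.
have [/Lp_measurable mV V0 _] := hV.
exact: (weak_solution_exists_unique ha1 ha2 mV V0 ((Lp2P f).1 hf)).
Qed.
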